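(* For the additive Gaussian noise channel with noise variance $N>0$ and power constraint $S>0$, for every real $a$ and every $0<\epsilon<1$, \[ C_p^{G}(a\mid N,S)=G\big(a/\sqrt{V}\big),\qquad C^{G}(\epsilon\mid N,S)=\sqrt{V}\,G^{-1}(\epsilon),\qquad\text{where } V=\frac{\frac{S^2}{N^2}+2\frac{S}{N}}{2(1+\frac SN)^2}. \]
   Context: Input and output alphabets are $\mathbb R$; $W_x$ is the normal distribution with mean $x$ and variance $N$, with density $\frac{1}{\sqrt{2\pi N}}e^{-(y-x)^2/(2N)}$, and $W^{\times n}_x=\prod_iW_{x_i}$ on $\mathbb R^n$. Logarithms are natural. $C^G_{N,S}=\frac12\log(1+\frac SN)$. A code for $W^{\times n}$ is $\Phi=(M,\phi,\{\mathcal D_i\}_{i=1}^M)$ with $\phi:\{1..M\}\to\mathbb R^n$ and pairwise disjoint Borel sets $\mathcal D_i\subset\mathbb R^n$; $|\Phi|=M$, $P_e(\Phi)=\frac1M\sum_i(1-W^{\times n}_{\phi(i)}(\mathcal D_i))$; it satisfies the power constraint if $\sum_{j=1}^n\phi(i)_j^2\le nS$ for every $i$. Over all code sequences satisfying the power constraint: $C_p^G(a|N,S)=\inf\{\limsup_nP_e(\Phi_n):\liminf_n\frac1{\sqrt n}(\log|\Phi_n|-nC^G_{N,S})\ge a\}$, $C^G(\epsilon|N,S)=\sup\{\liminf_n\frac1{\sqrt n}(\log|\Phi_n|-nC^G_{N,S}):\limsup_nP_e(\Phi_n)\le\epsilon\}$. $G$ is the standard normal distribution function. *)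

(* Defs.v *)
From HB Require Import structures.
From mathcomp Require Import all_boot all_order all_algebra.
From mathcomp Require Import all_classical all_reals all_analysis.
Set Implicit Arguments. Unset Strict Implicit. Unset Printing Implicit Defensive.
Import Order.TTheory GRing.Theory Num.Theory.
Local Open Scope classical_set_scope.
Local Open Scope ring_scope.

Section gaussian_channel.
Variable R : realType.

Definition W (N : R) (x : R) : set R -> \bar R := normal_prob x (Num.sqrt N).

(* W^{x n}_x : the n-fold product measure prod_i W_{x_i} on R^n = n.-tuple R
   (equipped with its product = Borel sigma-algebra), defined by iterated
   integration:  W^{x 0} is the Dirac mass at the empty tuple, and
   W^{x (n+1)}_x(D) = \int W_{x_0}(dy) W^{x n}_{(x_1..x_n)}({t | (y,t) \in D}). *)
Fixpoint Wn (N : R) (n : nat) : n.-tuple R -> set (n.-tuple R) -> \bar R :=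
  match n as m return m.-tuple R -> set (m.-tuple R) -> \bar R with
  | 0 => fun _ D => (\1_D [tuple] )%:E
  | n'.+1 => fun x D =>
      (\int[W N (thead x)]_y @Wn N n' [tuple of behead x] [set t | D (cons_tuple y t)])%E
  end.

Record code (n : nat) := Code {
  code_size : nat;
  code_size_gt0 : (0 < code_size)%N;
  enc : 'I_code_size -> n.-tuple R;
  dec : 'I_code_size -> set (n.-tuple R);
  dec_measurable : forall i, measurable (dec i);
  dec_disjoint : forall i j, i != j -> dec i `&` dec j = set0 }.

Definition Pe (N : R) n (c : code n) : R :=
  (code_size c)%:R^-1 *
  \sum_(i < code_size c) (1 - fine (Wn N (@enc n c i) (@dec n c i))).

Definition power_ok (S : R) n (c : code n) : Prop :=
  forall i, \sum_(j < n) (tnth (@enc n c i) j) ^+ 2 <= n%:R * S.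

Definition capG (N S : R) : R := 2^-1 * ln (1 + S / N).

Definition rate2 (N S : R) (c : forall n, code n) (n : nat) : \bar R :=
  ((ln (code_size (c n))%:R - n%:R * capG N S) / Num.sqrt n%:R)%:E.

Definition PeE (N : R) (c : forall n, code n) (n : nat) : \bar R :=
  (Pe N (c n))%:E.

Definition Cp (N S a : R) : \bar R :=
  ereal_inf [set limn_esup (PeE N c) | c in
    [set c : forall n, code n | (forall n, power_ok S (c n)) /\
                                (a%:E <= limn_einf (rate2 N S c))%E]].

Definition Ceps (N S eps : R) : \bar R :=
  ereal_sup [set limn_einf (rate2 N S c) | c in
    [set c : forall n, code n | (forall n, power_ok S (c n)) /\
                                (limn_esup (PeE N c) <= eps%:E)%E]].

Definition G (x : R) : R := fine (normal_prob 0 1 `]-oo, x]).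
Definition Ginv (e : R) : R := xget 0 [set x | G x = e].

End gaussian_channel.

(* Main.v *)
Require Import Defs.
From HB Require Import structures.
From mathcomp Require Import all_boot all_order all_algebra.
From mathcomp Require Import all_classical all_reals all_analysis.
From mathcomp Require Import measurable_realfun ring lra.
Set Implicit Arguments. Unset Strict Implicit. Unset Printing Implicit Defensive.
Import Order.TTheory GRing.Theory Num.Theory.
Import numFieldNormedType.Exports.
Local Open Scope classical_set_scope.
Local Open Scope ring_scope.

(** Let i(x, y) be the information density of W_x with respect to Q = N(0, N + S)^n.
    Under W_x it is nC plus a quadratic form in the independent Gaussian noise, so its
    fluctuations follow a central limit theorem that is uniform over the power ball.  This
    comes from Lindeberg swapping applied to the test functions G((c - s) / t):
    smoothing such a function by Gaussian noise only changes the scale t.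

    Converse: P_e >= W(i <= t) - e^t / M for every code, and on the power ball the
    distribution function of i at t is at least its value on the sphere of power nS, up to
    o(1), because decreasing the power lowers the mean more than the deviation matters.

    Achievability: Feinstein's greedy construction with codewords in a thin shell F below the
    sphere.  The shell keeps a positive N(0, S)^n-probability, and inputs distributed as
    N(0, S)^n have output distribution exactly Q, so that the decoding set U of a maximal code
    satisfies Q(U) >= tau P(F), which costs only O(1) in log M. *)

(** Uniformity over the power ball is the obstacle. A single coordinate of a codeword may carry the
    whole energy nS; its linear noise term, divided by sqrt n, then stays of order one, so the sum
    of the third absolute moments need not vanish and a generic Berry-Esseen bound gives nothing.
    But that linear term is exactly Gaussian, and averaging over it costs no error at all. Only the
    quadratic part a (v^2 - N) of a summand is replaced approximately, while the linear part b v is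
    kept in both functions being compared. Hence the error of one step contains |a|^3, |a| b^2 and
    a^2 |b| but no |b|^3, and its sum over the coordinates is controlled by n, [sumsq x] and
    [sumabs x], that is, by the power constraint alone. The test functions are stable under the
    step, so the argument is an induction on n; starting from a scale eta > 0 keeps every t at least
    eta, and the constants uniform. *)

(** * Integration against densities and Gaussian convolution *)

Section density.
Import HBNNSimple.

(** The usual approximation: indicators, then simple functions, then monotone convergence along
    [nnsfun_approx]. *)
Lemma ge0_integral_density d (T : measurableType d) (R : realType)
    (mu nu : {measure set T -> \bar R}) (g : T -> R) (f : T -> \bar R) :
  measurable_fun setT g -> (forall x, 0 <= g x) ->
  (forall A, measurable A -> nu A = (\int[mu]_(x in A) (g x)%:E)%E) ->
  measurable_fun setT f -> (forall x, 0 <= f x)%E ->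
  (\int[nu]_x f x = \int[mu]_x (f x * (g x)%:E))%E.
Proof.
move=> mg g0 nuE mf f0.
have mgE : measurable_fun setT (fun x => (g x)%:E) by exact/measurable_EFinP.
have indicE0 E : measurable E ->
    (\int[nu]_x (\1_E x)%:E = \int[mu]_x ((\1_E x)%:E * (g x)%:E))%E.
  move=> mE; rewrite integral_indic// setIT nuE//.
  rewrite integral_mkcond; apply: eq_integral => x _.
  by rewrite patchE indicE; case: ifPn => xE; rewrite ?mul1e ?mul0e.
pose f_ := nnsfun_approx measurableT mf.
have sfE n : (\int[nu]_x (f_ n x)%:E = \int[mu]_x ((f_ n x)%:E * (g x)%:E))%E.
  under [LHS]eq_integral do rewrite fimfunE -fsumEFin//.
  rewrite [LHS]ge0_integral_fsum//; last 2 first.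
    - by move=> r; exact/measurable_EFinP/measurableT_comp.
    - by move=> m x _; rewrite EFinM nnfun_muleindic_ge0.
  under [RHS]eq_integral.
    move=> x xD; rewrite fimfunE -fsumEFin// muleC ge0_mule_fsumr; last first.
      by move=> r; rewrite EFinM nnfun_muleindic_ge0.
    over.
  rewrite [RHS]ge0_integral_fsum//; last 2 first.
    - move=> r; apply: emeasurable_funM => //.
      by apply/measurable_EFinP; apply/measurableT_comp => //.
    - move=> m x _; rewrite mule_ge0//; first by rewrite lee_fin.
      by rewrite EFinM nnfun_muleindic_ge0.
  apply: eq_fsbigr => r; rewrite inE => -[x _ <-].
  have fx0 : (0 <= f_ n x) by [].
  under eq_integral do rewrite EFinM.
  under [RHS]eq_integral do rewrite EFinM muleCA (muleC (g _)%:E).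
  have mr : measurable (f_ n @^-1` [set f_ n x]) by exact: measurable_sfunP.
  rewrite !ge0_integralZl//.
  - by rewrite indicE0.
  - apply: emeasurable_funM => //.
    by apply/measurable_EFinP; exact: measurable_indic.
  - by move=> y _; rewrite mule_ge0// lee_fin.
  - by apply/measurable_EFinP; exact: measurable_indic.
transitivity (lim (\int[nu]_x (f_ n x)%:E @[n --> \oo])%E).
  rewrite -monotone_convergence//=.
  - apply: eq_integral => ? /[!inE] xD; apply/esym/cvg_lim => //=.
    exact: cvg_nnsfun_approx.
  - by move=> n; exact/measurable_EFinP/measurable_funTS.
  - by move=> n ? _; rewrite lee_fin.
  - by move=> ? _ ? ? mn; rewrite lee_fin; exact/lefP/nd_nnsfun_approx.
rewrite [RHS](_ : _ = lim
    (\int[mu]_x ((f_ n x)%:E * (g x)%:E) @[n --> \oo])%E); last first.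
  rewrite -monotone_convergence//=.
  - apply: eq_integral => x /[!inE] xD; apply/esym/cvg_lim => //.
    by apply: cvgeZr => //; exact: cvg_nnsfun_approx.
  - move=> n; apply: emeasurable_funM => //.
    exact/measurable_EFinP.
  - by move=> n x _; rewrite mule_ge0// lee_fin.
  - move=> x _ ? ? ?; apply: lee_wpmul2r; rewrite ?lee_fin//.
    exact/lefP/nd_nnsfun_approx.
by apply: congr_lim; apply/funext => n /=; exact: sfE.
Qed.
End density.

Lemma ge0_integral_normal_prob (R : realType) (m s : R) (f : R -> \bar R) :
  measurable_fun setT f -> (forall x, 0 <= f x)%E ->
  (\int[normal_prob m s]_x f x =
   \int[lebesgue_measure]_x (f x * (normal_pdf m s x)%:E))%E.
Proof.
move=> mf f0; apply: ge0_integral_density => //.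
- exact: measurable_normal_pdf.
- by move=> x; exact: normal_pdf_ge0.
Qed.

Lemma tonelli_EFin d1 d2 (T1 : measurableType d1) (T2 : measurableType d2) (R : realType)
    (m1 : {sigma_finite_measure set T1 -> \bar R})
    (m2 : {sigma_finite_measure set T2 -> \bar R}) (k : T1 * T2 -> R) :
  measurable_fun setT k -> (forall z, 0 <= k z) ->
  (\int[m1]_x \int[m2]_y (k (x, y))%:E = \int[m2]_y \int[m1]_x (k (x, y))%:E)%E.
Proof.
move=> mk k0; apply: (fubini_tonelli (fun z => (k z)%:E)).
  exact/measurable_EFinP.
by move=> z; rewrite lee_fin.
Qed.

Lemma normal_pdfE_sqr (R : realType) (m s x : R) : 0 < s ->
  normal_pdf m s x = (Num.sqrt (2 * pi) * s)^-1 * expR (- (x - m) ^+ 2 / (2 * s ^+ 2)).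
Proof.
move=> s0; rewrite normal_pdfE ?gt_eqF// /normal_peak /normal_fun.
congr (_^-1 * expR (_ / _)); last by rewrite mulr_natl.
rewrite -mulr_natl mulrCA mulrC sqrtrM ?mulr_ge0 ?pi_ge0//.
by rewrite sqrtr_sqr ger0_norm ?ltW.
Qed.

Lemma sqrD_gt0 (R : realType) (t b u : R) : 0 < t -> 0 <= u -> 0 < t ^+ 2 + b ^+ 2 * u.
Proof.
by move=> t0 u0; apply: ltr_pwDl; [exact: exprn_gt0|exact/mulr_ge0/u0/sqr_ge0].
Qed.

(** Two factorizations of the joint density of Y with law N(m, s^2) and W = b (Y - m) + t Z: prior
    times likelihood, and marginal of W times posterior of Y. The exponents agree by completing the
    square in y. *)
Lemma normal_pdf_mix (R : realType) (m b s t y w : R) : 0 < s -> 0 < t ->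
  let r := Num.sqrt (t ^+ 2 + b ^+ 2 * s ^+ 2) in
  normal_pdf m s y * normal_pdf (b * (y - m)) t w =
  normal_pdf 0 r w * normal_pdf (m + w * b * s ^+ 2 / r ^+ 2) (s * t / r) y.
Proof.
move=> s0 t0 r.
have r2 : r ^+ 2 = t ^+ 2 + b ^+ 2 * s ^+ 2.
  by rewrite sqr_sqrtr// ltW// sqrD_gt0// sqr_ge0.
have r0 : 0 < r by rewrite /r sqrtr_gt0 sqrD_gt0// sqr_ge0.
rewrite !normal_pdfE_sqr ?divr_gt0 ?mulr_gt0//.
have p0 : Num.sqrt (2 * pi) != 0 :> R by rewrite gt_eqF// sqrtr_gt0 mulr_gt0 ?pi_gt0.
rewrite mulrACA [in RHS]mulrACA -!expRD; congr (_ * expR _).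
  by field; rewrite ?p0 ?gt_eqF.
have rN0 : t ^+ 2 + b ^+ 2 * s ^+ 2 != 0 by rewrite -r2 gt_eqF ?exprn_gt0.
rewrite exprMn exprVn exprMn subr0 r2.
have s1 : s != 0 by rewrite gt_eqF.
have t1 : t != 0 by rewrite gt_eqF.
by field; rewrite exprMn rN0 s1 t1.
Qed.

Lemma normal_prob_le (R : realType) (m s c : R) : 0 < s ->
  normal_prob m s `]-oo, c] = (G ((c - m) / s))%:E.
Proof.
move=> s0.
pose F (x : R^o) : R := (x - m) / s.
have F'E : F^`()%classic = cst s^-1.
  apply/funext => x; rewrite /F derive1E deriveM// deriveD// derive_cst scaler0.
  by rewrite add0r derive_id derive_cst addr0 scaler1.
have FI : Num.sqrt (2 * pi) != 0 :> R by rewrite gt_eqF// sqrtr_gt0 mulr_gt0 ?pi_gt0.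
rewrite /G fineK; last first.
  by rewrite fin_num_measure.
rewrite /normal_prob -/(F c).
rewrite (@increasing_ge0_integration_by_substitutionNy _ F (normal_pdf 0 1) c).
- apply: eq_integral => x _; rewrite F'E !fctE/= !normal_pdfE_sqr// /F; congr EFin.
  rewrite [RHS]mulrAC; congr (_ * expR _).
    by field; rewrite ?FI ?gt_eqF.
  by field; rewrite ?gt_eqF.
- by move=> x y _ _ xy; rewrite /F ltr_pM2r ?invr_gt0// ltrD2r.
- by rewrite F'E => ? _; exact: cvg_cst.
- by rewrite F'E; exact: is_cvg_cst.
- by rewrite F'E; exact: cvg_cst.
- split; last first.
    apply: cvgM; last exact: cvg_cst.
    apply: cvgB; last exact: cvg_cst.
    exact: cvg_at_left_filter.
  by move=> x _; apply: derivableM => //; apply: derivableB.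
- by apply/gt0_cvgMlNy; [rewrite invr_gt0|exact: cvg_addrr_Ny].
- apply: continuous_subspaceT; apply: continuous_normal_pdf.
  by rewrite oner_eq0.
- by move=> x _; exact: normal_pdf_ge0.
Qed.

(** The integrand is the probability that b (y - x) + t Z <= s; averaging over y makes the left
    member a centered normal variable of variance t^2 + b^2 N. *)
Lemma integral_G_affine (R : realType) (N x b s t : R) : 0 < N -> 0 < t ->
  (\int[normal_prob x (Num.sqrt N)]_y (G ((s - b * (y - x)) / t))%:E =
   (G (s / Num.sqrt (t ^+ 2 + b ^+ 2 * N)))%:E)%E.
Proof.
move=> N0 t0.
have sN : 0 < Num.sqrt N by rewrite sqrtr_gt0.
pose r := Num.sqrt (t ^+ 2 + b ^+ 2 * Num.sqrt N ^+ 2).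
have r0 : 0 < r by rewrite /r sqrtr_gt0 sqrD_gt0// sqr_ge0.
have rE : r = Num.sqrt (t ^+ 2 + b ^+ 2 * N) by rewrite /r sqr_sqrtr// ltW.
pose h (z : R * R) : R := \1_(`]-oo, s] : set R) z.2 * normal_pdf (b * (z.1 - x)) t z.2.
have h0 z : 0 <= h z by rewrite mulr_ge0 ?normal_pdf_ge0.
have mh : measurable_fun setT h.
  apply: measurable_funM.
    apply: measurableT_comp => //; exact: measurable_indic.
  rewrite (_ : (fun _ => _) = fun z : R * R => (Num.sqrt (2 * pi) * t)^-1 *
     expR (- (z.2 - b * (z.1 - x)) ^+ 2 / (2 * t ^+ 2))); last first.
    by apply/funext => z; rewrite normal_pdfE_sqr.
  apply: measurable_funM => //; apply: measurableT_comp => //.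
  apply: measurable_funM => //; apply: measurableT_comp => //.
  apply: measurable_funX; apply: measurable_funB => //.
  apply: measurable_funM => //; apply: measurable_funB => //.
have GE y : (G ((s - b * (y - x)) / t))%:E =
    (\int[lebesgue_measure]_w (h (y, w))%:E)%E.
  rewrite -normal_prob_le// /normal_prob integral_mkcond.
  apply: eq_integral => w _; rewrite patchE /h indicE/=.
  by case: ifPn => _; rewrite ?mul1r ?mul0r.
have mI : measurable_fun setT (fun y : R => (G ((s - b * (y - x)) / t))%:E).
  under eq_fun do rewrite GE.
  apply: (@measurable_fun_fubini_tonelli_F _ _ _ _ _ lebesgue_measure (fun z => (h z)%:E)).
    exact/measurable_EFinP.
  by move=> z; rewrite lee_fin.
rewrite ge0_integral_normal_prob//; last first.
  by move=> y; rewrite GE integral_ge0// => w _; rewrite lee_fin.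
pose k (z : R * R) : R := h z * normal_pdf x (Num.sqrt N) z.1.
have mk : measurable_fun setT k.
  apply: measurable_funM => //.
  apply: measurableT_comp => //; exact: measurable_normal_pdf.
have k0 z : 0 <= k z by rewrite mulr_ge0 ?normal_pdf_ge0.
transitivity (\int[lebesgue_measure]_y \int[lebesgue_measure]_w (k (y, w))%:E)%E.
  apply: eq_integral => y _; rewrite GE.
  rewrite -ge0_integralZr//.
  - by apply/measurable_EFinP; apply: measurableT_comp => //; exact: measurable_fun_pair.
  - by move=> w _; rewrite lee_fin.
  - by rewrite lee_fin normal_pdf_ge0.
rewrite (tonelli_EFin lebesgue_measure lebesgue_measure mk k0).
(* After the exchange of integrals, [normal_pdf_mix] leaves the marginal density of w times a
   posterior density in y, which integrates to 1. *)
have kE w : (\int[lebesgue_measure]_y (k (y, w))%:E =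
    (\1_(`]-oo, s] : set R) w * normal_pdf 0 r w)%:E)%E.
  transitivity (\int[lebesgue_measure]_y ((\1_(`]-oo, s] : set R) w * normal_pdf 0 r w)%:E *
    (normal_pdf (x + w * b * Num.sqrt N ^+ 2 / r ^+ 2) (Num.sqrt N * t / r) y)%:E))%E.
    apply: eq_integral => y _; rewrite -EFinM; congr EFin; rewrite /k /h/=.
    rewrite -[LHS]mulrA -[RHS]mulrA; congr (_ * _); rewrite mulrC.
    exact: (normal_pdf_mix x b y w sN t0).
  rewrite ge0_integralZl//.
  - by rewrite integral_normal_pdf mule1.
  - by apply/measurable_EFinP; exact: measurable_normal_pdf.
  - by move=> y _; rewrite lee_fin normal_pdf_ge0.
  - by rewrite lee_fin mulr_ge0 ?normal_pdf_ge0.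
under eq_integral do rewrite kE.
rewrite -rE -(subr0 s) -normal_prob_le// subr0 /normal_prob [RHS]integral_mkcond.
apply: eq_integral => w _; rewrite patchE indicE/=.
by case: ifPn => _; rewrite ?mul1r ?mul0r.
Qed.

(** * The normal distribution function *)

(** Mean value theorem; the factor 1/(k+1) is given up so that K does not change. Chained three
    times, each remainder being up to sign the derivative of the next, it yields the Taylor bounds
    on [G]. *)
Lemma lipschitz_growth (R : realType) (f df : R -> R) (K : R) (k : nat) :
  (forall x : R, is_derive x 1 f (df x)) -> f 0 = 0 -> 0 <= K ->
  (forall x, `|df x| <= K * `|x| ^+ k) ->
  forall x, `|f x| <= K * `|x| ^+ k.+1.
Proof.
move=> fd f0 K0 dfK x.
have cf : continuous f.
  by move=> y; apply/differentiable_continuous/derivable1_diffP; exact: (@ex_derive _ _ _ _ _ _ _ (fd y)).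
have key c : `|c| <= `|x| -> `|df c * x| <= K * `|x| ^+ k.+1.
  move=> cx; rewrite normrM exprSr mulrA ler_wpM2r// (le_trans (dfK _))//.
  by rewrite ler_wpM2l// lerXn2r ?nnegrE.
have [x0|x0|x0] := ltgtP 0 x.
- have [c] := @MVT _ f df 0 x x0 (fun y _ => fd y) (continuous_subspaceT cf).
  rewrite in_itv/= => /andP[c0 cx].
  rewrite f0 !subr0 => ->; apply: key.
  by rewrite !gtr0_norm// ltW.
- have [c] := @MVT _ f df x 0 x0 (fun y _ => fd y) (continuous_subspaceT cf).
  rewrite in_itv/= => /andP[c0 cx].
  rewrite f0 !sub0r => /(congr1 -%R); rewrite opprK mulrN opprK => ->; apply: key.
  by rewrite !ltr0_norm// lerN2 ltW.
- by rewrite -x0 f0 normr0 exprS mul0r mulr0.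
Qed.

Definition phi {R : realType} (x : R) : R := normal_pdf 0 1 x.

Lemma phiE (R : realType) (x : R) :
  phi x = normal_peak 1 * expR (- (x ^+ 2 / 2)).
Proof.
rewrite /phi normal_pdfE ?oner_eq0// /normal_fun subr0 expr1n mulNr.
by rewrite mulr2n.
Qed.

Lemma is_derive_phi (R : realType) (x : R) : is_derive x 1 (@phi R) (- (x * phi x)).
Proof.
rewrite [X in is_derive _ _ X](_ : _ = fun x => normal_peak 1 * expR (- (x ^+ 2 / 2))).
  apply: is_derive_eq.
  rewrite phiE !scaler0 ?add0r ?addr0 /= /GRing.scale/=.
  by field.
by apply/funext => y; exact: phiE.
Qed.

Lemma continuous_phi (R : realType) : continuous (@phi R).
Proof. by apply: continuous_normal_pdf; rewrite oner_eq0. Qed.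

Lemma is_derive_G (R : realType) (x : R) : is_derive x 1 (@G R) (phi x).
Proof.
have xu : (x < x + 1) by rewrite ltrDl.
have := @continuous_FTC1 R (@phi R) -oo%O x (x + 1) xu.
have GE : @G R = fun x => (\int[lebesgue_measure]_(t in `]-oo, x]) (@phi R t)).
  by [].
rewrite -GE => /(_ _ _ (@continuous_phi R x))[].
- apply: (integrableS measurableT) => //; exact: integrable_normal_pdf.
- exact: ltNyr.
- by move=> dG G'; rewrite -G' derive1E; exact: derivableP.
Qed.

Lemma phi_ge0 (R : realType) (x : R) : 0 <= phi x.
Proof. exact: normal_pdf_ge0. Qed.

Lemma phi_gt0 (R : realType) (x : R) : 0 < phi x.
Proof. by rewrite phiE mulr_gt0 ?normal_peak_gt0 ?oner_eq0// expR_gt0. Qed.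

(** This is 1 + u <= exp u at u = x^2 / 2. *)
Lemma sqr_phi_le (R : realType) (x : R) : x ^+ 2 * phi x <= 2 * normal_peak 1.
Proof.
have p0 := @normal_peak_gt0 R 1 (oner_neq0 _).
rewrite phiE mulrCA mulrC ler_pM2r//.
rewrite expRN ler_pdivrMr ?expR_gt0//.
have := expR_ge1Dx (x ^+ 2 / 2); lra.
Qed.

Lemma phi_le (R : realType) (x : R) : phi x <= normal_peak 1.
Proof. by rewrite normal_pdf_ub ?oner_eq0. Qed.

(** The derivative (1 - z^2) phi z is at most one peak plus two peaks in absolute value; the
    constant 3 passes on to the next two bounds. *)
Lemma xphi_lip (R : realType) (x h : R) :
  `|(x + h) * phi (x + h) - x * phi x| <= 3 * normal_peak 1 * `|h|.
Proof.
have p0 := @normal_peak_gt0 R 1 (oner_neq0 _).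
pose f (h : R) := (x + h) * phi (x + h) - x * phi x.
pose df (h : R) := (1 - (x + h) ^+ 2) * phi (x + h).
apply: (@lipschitz_growth _ f df _ 0).
- move=> y; rewrite /f.
  have := @is_derive_phi R (x + y).
  move=> D.
  have D2 : is_derive y 1 (fun h : R => phi (x + h)) (- ((x + y) * phi (x + y))).
    apply: (@is_derive_eq _ _ _ _ _ _ _ _ (@is_derive1_comp _ _ _ _ _ _ D _)).
    by rewrite add0r mulr1.
  apply: is_derive_eq.
  by rewrite /df /GRing.scale/=; ring.
- by rewrite /f addr0 subrr.
- by rewrite mulr_ge0 ?ltW.
- move=> y; rewrite /df expr0 mulr1.
  have := sqr_phi_le (x + y); have := phi_le (x + y); have := phi_ge0 (x + y).
  have : 0 <= (x + y) ^+ 2 by exact: sqr_ge0.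
  move: (phi _) ((x + y) ^+ 2) => p q q0 p1 p2 p3.
  rewrite normrM (ger0_norm p1); apply: le_trans (_ : (1 + q) * p <= _).
    rewrite ler_wpM2r// (le_trans (ler_normB _ _))// normr1 ger0_norm//.
  lra.
Qed.

Lemma phi_taylor1 (R : realType) (x h : R) :
  `|phi (x + h) - phi x + h * (x * phi x)| <= 3 * normal_peak 1 * `|h| ^+ 2.
Proof.
have p0 := @normal_peak_gt0 R 1 (oner_neq0 _).
pose f (h : R) := phi (x + h) - phi x + h * (x * phi x).
apply: (@lipschitz_growth _ f (fun h => - ((x + h) * phi (x + h) - x * phi x)) _ 1).
- move=> y; rewrite /f.
  have D2 : is_derive y 1 (fun h : R => phi (x + h)) (- ((x + y) * phi (x + y))).
    have D := @is_derive_phi R (x + y).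
    apply: (@is_derive_eq _ _ _ _ _ _ _ _ (@is_derive1_comp _ _ _ _ _ _ D _)).
    by rewrite add0r mulr1.
  apply: is_derive_eq.
  by rewrite /GRing.scale/=; ring.
- by rewrite /f addr0 subrr mul0r addr0.
- by rewrite mulr_ge0 ?ltW.
- by move=> y; rewrite normrN expr1 xphi_lip.
Qed.

(** As phi' z = - z phi z, the second derivative of [G] appears as - x phi x. *)
Lemma G_taylor2 (R : realType) (x h : R) :
  `|G (x + h) - G x - h * phi x + h ^+ 2 / 2 * (x * phi x)| <= 3 * normal_peak 1 * `|h| ^+ 3.
Proof.
have p0 := @normal_peak_gt0 R 1 (oner_neq0 _).
pose f (h : R) := G (x + h) - G x - h * phi x + h ^+ 2 / 2 * (x * phi x).
apply: (@lipschitz_growth _ f (fun h => phi (x + h) - phi x + h * (x * phi x)) _ 2).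
- move=> y; rewrite /f.
  have D2 : is_derive y 1 (fun h : R => G (x + h)) (phi (x + y)).
    have D := @is_derive_G R (x + y).
    apply: (@is_derive_eq _ _ _ _ _ _ _ _ (@is_derive1_comp _ _ _ _ _ _ D _)).
    by rewrite add0r mulr1.
  apply: is_derive_eq.
  by rewrite /GRing.scale/=; field.
- by rewrite /f addr0 subrr mul0r subr0 expr0n/= !mul0r addr0.
- by rewrite mulr_ge0 ?ltW.
- by move=> y; exact: phi_taylor1.
Qed.

Lemma G_ge0 (R : realType) (x : R) : 0 <= G x.
Proof. by rewrite /G fine_ge0. Qed.

Lemma G_le1 (R : realType) (x : R) : G x <= 1.
Proof.
rewrite -lee_fin /G fineK ?fin_num_measure//.
exact: probability_le1.
Qed.

Lemma G_incr (R : realType) (x y : R) : x < y -> G x < G y.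
Proof.
move=> xy.
have cG : continuous (@G R).
  move=> z; apply/differentiable_continuous/derivable1_diffP.
  exact: (@ex_derive _ _ _ _ _ _ _ (is_derive_G z)).
have [c _ E] := @MVT _ (@G R) phi x y xy (fun y _ => is_derive_G y) (continuous_subspaceT cG).
by rewrite -subr_gt0 E mulr_gt0 ?subr_gt0// phi_gt0.
Qed.

Lemma G_mono (R : realType) (x y : R) : (G x <= G y) = (x <= y).
Proof. by apply: (le_mono (f := @G R)) => a b; exact: G_incr. Qed.

Lemma continuous_G (R : realType) : continuous (@G R).
Proof.
move=> z; apply/differentiable_continuous/derivable1_diffP.
exact: (@ex_derive _ _ _ _ _ _ _ (is_derive_G z)).
Qed.

Lemma measurable_G (R : realType) : measurable_fun setT (@G R).
Proof. exact: continuous_measurable_fun (@continuous_G R). Qed.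

(** Continuity from below, stated for general sets so that it serves both tails of [G]. *)
Lemma normal_prob_exhaust (R : realType) (F : nat -> set R) (e : R) : 0 < e ->
  (forall n, measurable (F n)) -> nondecreasing_seq F ->
  (forall x, exists n, F n x) -> exists n, 1 - e <= fine (normal_prob 0 1 (F n)).
Proof.
move=> e0 mF ndF Fx.
have UF : \bigcup_n F n = setT.
  by apply/seteqP; split=> // x _; have [n Fnx] := Fx x; exists n.
have /fine_cvgP[_] : normal_prob 0 1 (F n) @[n --> \oo] --> (1 : R)%:E.
  rewrite -(@probability_setT _ _ _ (normal_prob 0 1)) -UF.
  apply: nondecreasing_cvg_mu => //.
  by apply: bigcup_measurable => n _; exact: mF.
move=> /cvgrPdist_le/(_ _ e0)[n _ /(_ n (leqnn n))/=].
by move=> H; exists n; move: H; rewrite ler_norml /=; lra.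
Qed.

Lemma G_cvgy (R : realType) (e : R) : 0 < e -> exists M, forall x, M <= x -> 1 - e <= G x.
Proof.
move=> e0.
have [||||n Hn] := @normal_prob_exhaust R (fun n => `]-oo, n%:R]%classic) e => //.
- apply/nondecreasing_seqP => n; apply/subsetPset => x /=.
  by rewrite !in_itv/= => /le_trans; apply; rewrite ler_nat.
- move=> x; exists (Num.truncn x).+1; rewrite /= in_itv/=.
  by rewrite ltW// truncnS_gt.
- by exists n%:R => x nx; apply: (le_trans Hn); rewrite -/(G _) G_mono.
Qed.

Lemma G_cvgNy (R : realType) (e : R) : 0 < e -> exists M, forall x, x <= M -> G x <= e.
Proof.
move=> e0.
have [||||n Hn] := @normal_prob_exhaust R (fun n => ~` `]-oo, - n%:R]%classic) e => //.
- by move=> n; apply: measurableC.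
- apply/nondecreasing_seqP => n; apply/subsetPset; apply: subsetC => x /=.
  by rewrite !in_itv/= => /le_trans; apply; rewrite lerN2 ler_nat.
- move=> x; exists (Num.truncn (- x)).+1; rewrite /= in_itv/=; apply/negP.
  by rewrite -ltNge ltrNl truncnS_gt.
- exists (- n%:R) => x nx; apply: (@le_trans _ _ (G (- n%:R))); first by rewrite G_mono.
  move: Hn; rewrite probability_setC// fineB ?fin_num_measure//.
  by rewrite -/(G _) /=; lra.
Qed.

(** Makes [Ginv], a choice with default value 0, a genuine right inverse of [G] on the open unit
    interval. *)
Lemma G_surj (R : realType) (e : R) : 0 < e < 1 -> exists x, G x = e.
Proof.
move=> /andP[e0 e1].
have [M GM] := G_cvgNy e0.
have [M' GM'] : exists M, forall x, M <= x -> 1 - (1 - e) <= @G R x.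
  by apply: G_cvgy; rewrite subr_gt0.
pose a := Num.min M M'; pose b := Num.max M M'.
have ab : a <= b by rewrite ge_min le_max lexx.
have [||c _ Gc] := @IVT _ (@G R) a b e ab.
- exact: continuous_subspaceT (@continuous_G R).
- rewrite ge_min le_max GM ?ge_min ?lexx//= orbC.
  by have := GM' b; rewrite opprB addrCA subrr addr0 le_max lexx orbT => ->.
- by exists c.
Qed.

(** * Gaussian moments and the Lindeberg step *)

Lemma integral_density d (T : measurableType d) (R : realType)
    (mu nu : {measure set T -> \bar R}) (g : T -> R) (f : T -> \bar R) :
  measurable_fun setT g -> (forall x, 0 <= g x) ->
  (forall A, measurable A -> nu A = (\int[mu]_(x in A) (g x)%:E)%E) ->
  measurable_fun setT f ->
  (\int[nu]_x f x = \int[mu]_x (f x * (g x)%:E))%E.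
Proof.
move=> mg g0 nuE mf; rewrite integralE [RHS]integralE.
rewrite (ge0_integral_density mg g0 nuE)//; last exact: measurable_funepos.
rewrite (ge0_integral_density mg g0 nuE)//; last exact: measurable_funeneg.
congr (_ - _)%E; apply: eq_integral => x _.
  rewrite !funeposE maxe_pMl ?lee_fin// ?mul0e//.
rewrite !funenegE maxe_pMl ?lee_fin// ?mul0e// mulNe//.
Qed.

Lemma integral_normal_prob (R : realType) (m s : R) (f : R -> \bar R) :
  measurable_fun setT f ->
  (\int[normal_prob m s]_x f x =
   \int[lebesgue_measure]_x (f x * (normal_pdf m s x)%:E))%E.
Proof.
move=> mf; apply: integral_density => //.
- exact: measurable_normal_pdf.
- by move=> x; exact: normal_pdf_ge0.
Qed.

(** Half of the exponent u / (2N), with u = (y - x)^2, is spent on the polynomial: it is four times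
    u / (16N), and 1 + u <= (1 + 16N) exp(u / (16N)). The other half is the exponent of the normal
    density of variance 2N. *)
Lemma poly_normal_pdf_le (R : realType) (N : R) : 0 < N -> exists2 C, 0 <= C &
  forall x y, (1 + (y - x) ^+ 2) ^+ 4 * normal_pdf x (Num.sqrt N) y <=
    C * normal_pdf x (Num.sqrt (2 * N)) y.
Proof.
move=> N0.
have s0 : 0 < Num.sqrt N by rewrite sqrtr_gt0.
have s20 : 0 < Num.sqrt (2 * N) by rewrite sqrtr_gt0 mulr_gt0.
have p0 : 0 < Num.sqrt (2 * pi) :> R by rewrite sqrtr_gt0 mulr_gt0// pi_gt0.
exists ((1 + 16 * N) ^+ 4 * (Num.sqrt (2 * N) / Num.sqrt N)).
  by rewrite mulr_ge0// ?divr_ge0 ?sqrtr_ge0// exprn_ge0// addr_ge0// mulr_ge0// ltW.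
move=> x y; rewrite !normal_pdfE_sqr//.
have : 0 <= (y - x) ^+ 2 by exact: sqr_ge0.
move: ((y - x) ^+ 2) => u u0.
rewrite !sqr_sqrtr; [|lra|lra].
have -> : (1 + 16 * N) ^+ 4 * (Num.sqrt (2 * N) / Num.sqrt N) *
  ((Num.sqrt (2 * pi) * Num.sqrt (2 * N))^-1 * expR (- u / (2 * (2 * N)))) =
  (Num.sqrt (2 * pi) * Num.sqrt N)^-1 * ((1 + 16 * N) ^+ 4 * expR (- u / (2 * (2 * N)))).
  by field; rewrite !gt_eqF.
rewrite mulrCA ler_pM2l ?invr_gt0 ?mulr_gt0//.
have -> : - u / (2 * N) = - u / (2 * (2 * N)) - u / (16 * N) *+ 4.
  by field; rewrite gt_eqF.
rewrite expRD mulrCA [leRHS]mulrC ler_pM2l ?expR_gt0//.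
have -> : - (u / (16 * N) *+ 4) = 4%:R * - (u / (16 * N)) by rewrite -mulr_natl mulrN.
rewrite expRM_natl expRN exprVn ler_pdivrMr ?exprn_gt0 ?expR_gt0// -exprMn.
apply: lerXn2r; rewrite ?nnegrE.
- lra.
- by rewrite mulr_ge0 ?expR_ge0//; lra.
have e1 := expR_ge1Dx (u / (16 * N)).
apply: le_trans (_ : (1 + 16 * N) * (1 + u / (16 * N)) <= _); last first.
  by rewrite ler_wpM2l//; lra.
have -> : (1 + 16 * N) * (1 + u / (16 * N)) = 1 + u + 16 * N + u / (16 * N).
  by field; rewrite gt_eqF.
have : 0 <= u / (16 * N) by rewrite divr_ge0//; lra.
lra.
Qed.

Lemma integral_poly_normal (R : realType) (N : R) : 0 < N -> exists2 C, 0 <= C &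
  forall x, (\int[normal_prob x (Num.sqrt N)]_y ((1 + (y - x) ^+ 2) ^+ 4)%:E <= C%:E)%E.
Proof.
move=> N0; have [C C0 HC] := poly_normal_pdf_le N0; exists C => // x.
have mp : measurable_fun setT (fun y : R => (1 + (y - x) ^+ 2) ^+ 4).
  by apply: measurable_funX; apply: measurable_funD => //; apply: measurable_funX; exact: measurable_funB.
have pp (y : R) : 0 <= (1 + (y - x) ^+ 2) ^+ 4.
  by rewrite exprn_ge0// addr_ge0// sqr_ge0.
rewrite ge0_integral_normal_prob//; last exact/measurable_EFinP.
apply: (@le_trans _ _ (\int[lebesgue_measure]_y (C%:E * (normal_pdf x (Num.sqrt (2 * N)) y)%:E))%E).
  apply: ge0_le_integral => //.
  - by move=> y _; rewrite -EFinM lee_fin mulr_ge0// normal_pdf_ge0.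
  - apply/measurable_EFinP; apply: measurable_funM => //; exact: measurable_normal_pdf.
  - apply/measurable_EFinP; apply: measurable_funM => //; exact: measurable_normal_pdf.
  - by move=> y _; rewrite -!EFinM lee_fin.
rewrite ge0_integralZl//.
- by rewrite integral_normal_pdf mule1.
- by apply/measurable_EFinP; exact: measurable_normal_pdf.
- by move=> y _; rewrite lee_fin normal_pdf_ge0.
Qed.

Lemma integrable_poly_growth (R : realType) (N x c : R) (f : R -> R) : 0 < N ->
  measurable_fun setT f -> (forall y, `|f y| <= c * (1 + (y - x) ^+ 2) ^+ 4) ->
  (normal_prob x (Num.sqrt N)).-integrable setT (EFin \o f).
Proof.
move=> N0 mf fc.
have mp : measurable_fun setT (fun y : R => (1 + (y - x) ^+ 2) ^+ 4).
  by apply: measurable_funX; apply: measurable_funD => //; apply: measurable_funX; exact: measurable_funB.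
have [C C0 HC] := integral_poly_normal N0.
have ip : (normal_prob x (Num.sqrt N)).-integrable setT
    (EFin \o (fun y : R => (1 + (y - x) ^+ 2) ^+ 4)).
  apply/integrableP; split; first exact/measurable_EFinP.
  apply: le_lt_trans (ltry C); apply: le_trans (HC x).
  rewrite le_eqVlt; apply/orP; left; apply/eqP.
  apply: eq_integral => y _ /=.
  by rewrite ger0_norm// exprn_ge0// addr_ge0// sqr_ge0.
apply: (le_integrable measurableT) (integrableZl measurableT c ip).
  exact/measurable_EFinP.
move=> y _ /=; rewrite lee_fin (le_trans (fc y))//.
exact: ler_norm.
Qed.

(** The fundamental theorem of calculus on intervals growing around x: dominated convergence gives
    the limit of the integrals, and the decay of F kills the boundary terms. *)
Lemma integral_derivative_eq0 (R : realType) (x D : R) (F f : R -> R) :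
  (forall y : R, is_derive y 1 F (f y)) -> continuous f ->
  lebesgue_measure.-integrable setT (EFin \o f) ->
  (forall y, `|F y| * (1 + (y - x) ^+ 2) <= D) ->
  (\int[lebesgue_measure]_y (f y)%:E = 0)%E.
Proof.
move=> Ff cf fi FD.
have cF : continuous F.
  by move=> y; apply/differentiable_continuous/derivable1_diffP; exact: (@ex_derive _ _ _ _ _ _ _ (Ff y)).
have FE (n : nat) : (\int[lebesgue_measure]_y ((EFin \o f) \_ `[(x - n.+1%:R)%R, (x + n.+1%:R)%R]) y =
   (F (x + n.+1%:R) - F (x - n.+1%:R))%:E)%E.
  have nn : 0 < n.+1%:R :> R by [].
  rewrite -integral_mkcond (@continuous_FTC2 _ f F)//; first by lra.
  - exact: continuous_subspaceT.
  - split.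
    + by move=> y _; exact: (@ex_derive _ _ _ _ _ _ _ (Ff y)).
    + by apply: cvg_at_right_filter; exact: cF.
    + by apply: cvg_at_left_filter; exact: cF.
  - by move=> y _; rewrite derive1E; exact: derive_val.
have mf := measurable_int _ fi.
have [|||||_ _] := @dominated_convergence _ _ _ lebesgue_measure setT measurableT
   (fun n => ((EFin \o f) \_ `[(x - n.+1%:R)%R, (x + n.+1%:R)%R])) (EFin \o f) (abse \o (EFin \o f)).
- by move=> n; apply/(measurable_restrictT _ (measurable_itv _)); exact: measurable_funTS.
- exact: mf.
- apply: aeW => y _.
  apply: cvg_near_cst.
  near=> n.
  rewrite patchE mem_set//= in_itv/=.
  have : `|y - x| <= n.+1%:R.
    near: n; exists (Num.truncn `|y - x|) => // n /= hn.
    rewrite ltW// (lt_le_trans (truncnS_gt _))// ler_nat ltnS.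
    exact: hn.
  by rewrite ler_norml; lra.
- exact: integrable_abse.
- apply: aeW => n y _; rewrite patchE; case: ifPn => // _; rewrite ?lexx//.
  by rewrite abse0 abse_ge0.
move=> H.
have {H}H1 : (fun n => (F (x + n.+1%:R) - F (x - n.+1%:R))%:E) @ \oo -->
    (\int[lebesgue_measure]_y (EFin \o f) y)%E.
  rewrite [X in X @ _](_ : _ = fun n => (\int[lebesgue_measure]_y
     ((EFin \o f) \_ `[(x - n.+1%:R)%R, (x + n.+1%:R)%R]) y)%E) //.
  by apply/funext => n; rewrite FE.
have H2 : (fun n => (F (x + n.+1%:R) - F (x - n.+1%:R))%:E) @ \oo --> 0%:E.
  apply: cvg_EFin; first by near=> n.
  apply/cvgr0Pnorm_le => e e0.
  near=> n => /=.
  have nn : (1 : R) <= n.+1%:R by rewrite ler1n.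
  have Fp z : (z = n.+1%:R) \/ z = - n.+1%:R -> `|F (x + z)| <= D / n.+1%:R.
    move=> zE; have := FD (x + z).
    have -> : (x + z - x) ^+ 2 = n.+1%:R ^+ 2.
      by case: zE => ->; ring.
    move=> H; rewrite ler_pdivlMr//; apply: le_trans H.
    by rewrite ler_wpM2l//; nra.
  rewrite (le_trans (ler_normB _ _))//.
  apply: (@le_trans _ _ (D / n.+1%:R + D / n.+1%:R)).
    by apply: lerD; apply: Fp; [left|right].
  rewrite -mulrDl ler_pdivrMr// mulrC -ler_pdivrMr//.
  near: n; exists (Num.truncn ((D + D) / e)) => // n /= hn.
  rewrite ltW// (lt_le_trans (truncnS_gt _))// ler_nat ltnS.
  exact: hn.
by rewrite -(cvg_lim _ H1)// (cvg_lim _ H2).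
Unshelve. all: by end_near. Qed.

Lemma poly_growth_le (R : realType) (v : R) (k : nat) : (k <= 8)%N ->
  `|v| ^+ k <= (1 + v ^+ 2) ^+ 4.
Proof.
move=> k8.
have v0 := normr_ge0 v.
have vE : v ^+ 2 = `|v| ^+ 2 by rewrite real_normK ?num_real.
have [v1|v1] := lerP `|v| 1.
  apply: (@le_trans _ _ 1); first by rewrite exprn_ile1.
  by rewrite exprn_ege1// vE lerDl exprn_ge0.
apply: (@le_trans _ _ (`|v| ^+ 8)); first by rewrite ler_weXn2l// ltW.
rewrite vE (_ : 8 = 2 * 4)%N// exprM lerXn2r ?nnegrE ?exprn_ge0//.
by rewrite lerDr.
Qed.

Lemma integrable_normal_moment (R : realType) (N x : R) (k : nat) : 0 < N -> (k <= 8)%N ->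
  (normal_prob x (Num.sqrt N)).-integrable setT (EFin \o (fun y => (y - x) ^+ k)).
Proof.
move=> N0 k8; apply: (@integrable_poly_growth _ _ x 1) => //.
  by apply: measurable_funX; exact: measurable_funB.
by move=> y; rewrite mul1r normrX poly_growth_le.
Qed.

Lemma Rintegral_normal_prob_cst (R : realType) (m s c : R) :
  \int[normal_prob m s]_y c = c.
Proof. transitivity (c * fine (normal_prob m s setT)); first exact: Rintegral_cst.
by rewrite probability_setT mulr1. Qed.

(* Integration by parts: (v^k pdf)' = (k v^(k-1) - v^(k+1) / N) pdf *)
Lemma normal_moment_rec (R : realType) (N x : R) (k : nat) : 0 < N -> (k <= 3)%N ->
  \int[normal_prob x (Num.sqrt N)]_y ((y - x) ^+ k.+1) =
  N * k%:R * \int[normal_prob x (Num.sqrt N)]_y ((y - x) ^+ k.-1).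
Proof.
move=> N0 k3.
have s0 : 0 < Num.sqrt N by rewrite sqrtr_gt0.
have sE : Num.sqrt N ^+ 2 = N by rewrite sqr_sqrtr// ltW.
(* At k = 0 the truncated predecessor is harmless: the factor [k%:R] removes the term, as in the
   derivative of a constant. *)
pose f (y : R) := k%:R * (y - x) ^+ k.-1 - N^-1 * (y - x) ^+ k.+1.
have i1 : (normal_prob x (Num.sqrt N)).-integrable setT (EFin \o (fun y => k%:R * (y - x) ^+ k.-1)).
  apply: (integrableZl measurableT k%:R (@integrable_normal_moment R N x k.-1 N0 _)).
  by rewrite (leq_trans (leq_pred _))// (leq_trans k3).
have i2 : (normal_prob x (Num.sqrt N)).-integrable setT (EFin \o (fun y => N^-1 * (y - x) ^+ k.+1)).
  apply: (integrableZl measurableT N^-1 (@integrable_normal_moment R N x k.+1 N0 _)).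
  by rewrite (leq_ltn_trans k3).
have mf : measurable_fun setT f.
  apply: measurable_funB; apply: measurable_funM => //; apply: measurable_funX; exact: measurable_funB.
suff fI : (\int[normal_prob x (Num.sqrt N)]_y (f y)%:E = 0)%E.
  have : \int[normal_prob x (Num.sqrt N)]_y f y = 0 by rewrite /Rintegral fI.
  rewrite RintegralB// !RintegralZl//; last 2 first.
    by apply: integrable_normal_moment => //; rewrite (leq_ltn_trans k3).
    apply: integrable_normal_moment => //.
    by rewrite (leq_trans (leq_pred _))// (leq_trans k3).
  move/eqP; rewrite subr_eq0 => /eqP H.
  by rewrite -mulrA H mulrA mulfV ?gt_eqF// mul1r.
rewrite integral_normal_prob//; last exact/measurable_EFinP.
have [C C0 HC] := poly_normal_pdf_le N0.
pose p (y : R) := normal_pdf x (Num.sqrt N) y.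
have pD (y : R) : is_derive y 1 p (- ((y - x) / N) * p y).
  rewrite (_ : p = fun y => (Num.sqrt (2 * pi) * Num.sqrt N)^-1 * expR (- (2 * N)^-1 * (y - x) ^+ 2)); last first.
    by apply/funext => z; rewrite /p normal_pdfE_sqr// sE; congr (_ * expR _); rewrite mulrC mulrN mulNr.
  apply: is_derive_eq.
  rewrite /GRing.scale/= ; field; rewrite !gt_eqF// sqrtr_gt0 mulr_gt0// pi_gt0//.
apply: (@integral_derivative_eq0 _ x (C * normal_peak (Num.sqrt (2 * N))) (fun y => (y - x) ^+ k * p y) (fun y => f y * p y)).
- move=> y; have H := pD y.
  have kD : is_derive y 1 (fun y : R => (y - x) ^+ k) (k%:R * (y - x) ^+ k.-1).
    case: (k) k3 => [|[|[|[|//]]]] _; [|by apply: is_derive_eq; rewrite /GRing.scale/=; ring..].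
    rewrite (_ : (fun y : R => _) = cst 1); last by apply/funext => z; rewrite expr0.
    by rewrite mul0r; exact: is_derive_cst.
  apply: is_derive_eq.
  by rewrite /GRing.scale/= /f [_ ^+ k.+1]exprSr; field; rewrite gt_eqF.
- have cv j : continuous (fun y : R => (y - x) ^+ j).
    move=> y; apply: (@continuous_comp _ _ _ (fun y => y - x) (fun z => z ^+ j)).
      by apply: cvgB; [exact: cvg_id|exact: cvg_cst].
    exact: exprn_continuous.
  move=> y; apply: cvgM; last by apply: continuous_normal_pdf; rewrite gt_eqF.
  by apply: cvgB; apply: cvgM; by [exact: cvg_cst|exact: cv].
- have /integrableP[_ fi] : (normal_prob x (Num.sqrt N)).-integrable setT (EFin \o f).
    exact: (integrableB measurableT i1 i2).
  apply/integrableP; split.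
    by apply/measurable_EFinP; apply: measurable_funM => //; exact: measurable_normal_pdf.
  apply: le_lt_trans fi; rewrite ge0_integral_normal_prob//.
    rewrite le_eqVlt; apply/orP; left; apply/eqP; apply: eq_integral => y _ /=.
    by rewrite normrM [X in _ * X]ger0_norm ?normal_pdf_ge0.
  by apply/measurable_EFinP; exact: measurableT_comp.
- move=> y; rewrite normrM normrX (ger0_norm (normal_pdf_ge0 _ _ _)).
  apply: (@le_trans _ _ (C * normal_pdf x (Num.sqrt (2 * N)) y)); last first.
    by rewrite ler_wpM2l// normal_pdf_ub// gt_eqF// sqrtr_gt0 mulr_gt0.
  apply: le_trans (HC x y).
  rewrite mulrAC ler_wpM2r ?normal_pdf_ge0//.
  (* As k <= 3, three of the four factors 1 + v^2 dominate v^k, and the fourth provides the decay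
     required of the primitive. *)
  have : `|y - x| ^+ k <= (1 + (y - x) ^+ 2) ^+ 3.
    set v := y - x.
    have vE : v ^+ 2 = `|v| ^+ 2 by rewrite real_normK ?num_real.
    have : `|v| <= 1 + v ^+ 2 by rewrite vE; nra.
    move=> v1; have v2 : 1 <= 1 + v ^+ 2 by rewrite lerDl sqr_ge0.
    apply: (@le_trans _ _ ((1 + v ^+ 2) ^+ k)).
      by rewrite lerXn2r ?nnegrE// (le_trans _ v2).
    by rewrite ler_weXn2l.
  rewrite [X in _ -> _ <= X]exprSr => H; rewrite ler_wpM2r//.
  by rewrite addr_ge0// sqr_ge0.
Qed.

Lemma normal_moment1 (R : realType) (N x : R) : 0 < N ->
  \int[normal_prob x (Num.sqrt N)]_y (y - x) = 0.
Proof.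
move=> N0; have := @normal_moment_rec R N x 0 N0 isT.
by rewrite mulr0 mul0r => <-; apply: eq_Rintegral => y _; rewrite expr1.
Qed.

Lemma normal_moment2 (R : realType) (N x : R) : 0 < N ->
  \int[normal_prob x (Num.sqrt N)]_y ((y - x) ^+ 2) = N.
Proof.
move=> N0; rewrite (@normal_moment_rec R N x 1 N0 isT)/=.
rewrite (_ : \int[_]_y _ = 1) ?mulr1//.
rewrite -[RHS](@Rintegral_normal_prob_cst R x (Num.sqrt N) 1).
by apply: eq_Rintegral => y _; rewrite expr0.
Qed.

Lemma normal_moment3 (R : realType) (N x : R) : 0 < N ->
  \int[normal_prob x (Num.sqrt N)]_y ((y - x) ^+ 3) = 0.
Proof.
move=> N0; rewrite (@normal_moment_rec R N x 2 N0 isT)/=.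
rewrite (_ : \int[_]_y _ = 0) ?mulr0// -[RHS](normal_moment1 x N0).
by apply: eq_Rintegral => y _; rewrite expr1.
Qed.

Lemma normal_moment4 (R : realType) (N x : R) : 0 < N ->
  \int[normal_prob x (Num.sqrt N)]_y ((y - x) ^+ 4) = 3 * N ^+ 2.
Proof.
move=> N0; rewrite (@normal_moment_rec R N x 3 N0 isT)/= normal_moment2//.
by ring.
Qed.

Ltac nneg := repeat first [done | exact: sqr_ge0 | apply: mulr_ge0 | apply: addr_ge0 | apply: exprn_ge0
  | rewrite invr_ge0 | apply: normr_ge0 | exact: ltW].

(** Expansions are integrated through the moments 0, N, 0, 3 N^2 of v, and the remainder through its
    weight, whose mean is at most M for every x. Degree four is reached by the square of v^2 - N. *)
Lemma integral_near_quartic (R : realType) (N : R) : 0 < N -> exists2 M, 0 <= M &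
  forall (x c0 c1 c2 c3 c4 E : R) (f : R -> R), measurable_fun setT f -> 0 <= E ->
  (forall y, let v := y - x in
     `|f y - (c0 + c1 * v + c2 * v ^+ 2 + c3 * v ^+ 3 + c4 * v ^+ 4)| <=
     E * (1 + v ^+ 2) ^+ 4) ->
  `|\int[normal_prob x (Num.sqrt N)]_y f y - (c0 + c2 * N + c4 * (3 * N ^+ 2))| <= E * M.
Proof.
move=> N0; have [M M0 HM] := integral_poly_normal N0; exists M => // x c0 c1 c2 c3 c4 E f mf E0 fE.
set P := normal_prob x (Num.sqrt N).
pose p (y : R) := c0 + c1 * (y - x) + c2 * (y - x) ^+ 2 + c3 * (y - x) ^+ 3 + c4 * (y - x) ^+ 4.
pose r y := f y - p y.
have im c k : (k <= 8)%N -> P.-integrable setT (EFin \o (fun y => c * (y - x) ^+ k)).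
  by move=> k8; exact: (integrableZl measurableT c (integrable_normal_moment x N0 k8)).
have i0 : P.-integrable setT (EFin \o (fun y : R => c0)).
  by rewrite (_ : _ \o _ = EFin \o (fun y => c0 * (y - x) ^+ 0)) ?im//; apply/funext => y /=; rewrite mulr1.
have i1 : P.-integrable setT (EFin \o (fun y : R => c1 * (y - x))).
  by rewrite (_ : _ \o _ = EFin \o (fun y => c1 * (y - x) ^+ 1)) ?im//; apply/funext => y /=; rewrite expr1.
have i2 := im c2 2 isT; have i3 := im c3 3 isT; have i4 := im c4 4 isT.
have i01 : P.-integrable setT (EFin \o (fun y : R => c0 + c1 * (y - x))).
  exact: (integrableD measurableT i0 i1).
have i012 : P.-integrable setT (EFin \o (fun y : R => c0 + c1 * (y - x) + c2 * (y - x) ^+ 2)).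
  exact: (integrableD measurableT i01 i2).
have i0123 : P.-integrable setT (EFin \o (fun y : R => c0 + c1 * (y - x) + c2 * (y - x) ^+ 2 + c3 * (y - x) ^+ 3)).
  exact: (integrableD measurableT i012 i3).
have ip : P.-integrable setT (EFin \o p) by exact: (integrableD measurableT i0123 i4).
have mp : measurable_fun setT p by apply/measurable_EFinP; exact: measurable_int ip.
have mr : measurable_fun setT r by exact: measurable_funB.
have ir : P.-integrable setT (EFin \o r).
  by apply: (@integrable_poly_growth _ _ x E) => // y; exact: fE.
have pI : \int[P]_y p y = c0 + c2 * N + c4 * (3 * N ^+ 2).
  rewrite /p !RintegralD// !RintegralZl//; try exact: integrable_normal_moment.
    rewrite Rintegral_normal_prob_cst normal_moment1// normal_moment2// normal_moment3// normal_moment4//.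
    by ring.
  by have := integrable_normal_moment x N0 (isT : (1 <= 8)%N); under eq_fun do rewrite expr1.
have -> : \int[P]_y f y - (c0 + c2 * N + c4 * (3 * N ^+ 2)) = \int[P]_y r y.
  rewrite -pI -RintegralB//.
  rewrite (_ : f = p \+ r); last by apply/funext => y; rewrite /r /= addrCA subrr addr0.
  exact: (integrableD measurableT ip ir).
apply: le_trans (le_normr_Rintegral measurableT ir) _.
have mP : measurable_fun setT (fun y : R => (1 + (y - x) ^+ 2) ^+ 4).
  by apply: measurable_funX; apply: measurable_funD => //; apply: measurable_funX; exact: measurable_funB.
have iP : P.-integrable setT (EFin \o (fun y : R => (1 + (y - x) ^+ 2) ^+ 4)).
  apply: (@integrable_poly_growth _ _ x 1) => // y.
  by rewrite mul1r ger0_norm// exprn_ge0// addr_ge0// sqr_ge0.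
apply: (@le_trans _ _ (\int[P]_y (E * (1 + (y - x) ^+ 2) ^+ 4))).
  apply: le_Rintegral => //.
  - exact: (integrable_abse ir).
  - exact: (integrableZl measurableT E iP).
  - by move=> y _; exact: fE.
rewrite RintegralZl// ler_wpM2l//.
rewrite -lee_fin /Rintegral fineK; first exact: HM.
exact: integrable_fin_num.
Qed.

Lemma Rintegral_G_affine (R : realType) (N x b s t : R) : 0 < N -> 0 < t ->
  \int[normal_prob x (Num.sqrt N)]_y (G ((s - b * (y - x)) / t)) =
   G (s / Num.sqrt (t ^+ 2 + b ^+ 2 * N)).
Proof. by move=> N0 t0; rewrite /Rintegral integral_G_affine. Qed.

Lemma ler_normM_bound (R : realType) (x y a b : R) : `|x| <= a -> `|y| <= b -> `|x * y| <= a * b.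
Proof. by move=> xa yb; rewrite normrM ler_pM. Qed.

(** The effect of a change of scale, found without differentiating in the scale: the average of G((s
    - b y) / t) is known exactly from [Rintegral_G_affine], and to third order from the Taylor
    expansion in b y. *)
Lemma G_smooth_taylor (R : realType) (N eta : R) : 0 < N -> 0 < eta -> exists2 C, 0 <= C &
  forall s b t, eta <= t ->
  `|G (s / Num.sqrt (t ^+ 2 + b ^+ 2 * N)) - G (s / t) + b ^+ 2 * N / (2 * t ^+ 2) * (s / t * phi (s / t))|
   <= C * `|b| ^+ 3.
Proof.
move=> N0 eta0; have [M M0 HM] := integral_near_quartic N0.
have p0 := @normal_peak_gt0 R 1 (oner_neq0 _).
exists (3 * normal_peak 1 * (eta^-1) ^+ 3 * M).
  by nneg.
move=> s b t et; have t0 : 0 < t by exact: lt_le_trans et.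
have := HM 0 (G (s / t)) (- (b / t * phi (s / t))) (- (b ^+ 2 / (2 * t ^+ 2) * (s / t * phi (s / t)))) 0 0
  (3 * normal_peak 1 * (eta^-1) ^+ 3 * `|b| ^+ 3) (fun y : R => G ((s - b * (y - 0)) / t)).
rewrite Rintegral_G_affine// => H.
apply: le_trans (le_trans (H _ _ _) _).
- rewrite le_eqVlt; apply/orP; left; apply/eqP; congr `| _ |.
  by ring.
- apply: (measurableT_comp (@measurable_G R)).
  by apply: measurable_funM => //; apply: measurable_funB => //; apply: measurable_funM => //; exact: measurable_funB.
- by nneg.
- move=> y; rewrite subr0.
  have := G_taylor2 (s / t) (- (b * y / t)).
  rewrite (_ : s / t + _ = (s - b * y) / t); last by field; rewrite gt_eqF.
  move=> T; apply: (@le_trans _ _ (3 * normal_peak 1 * `|- (b * y / t)| ^+ 3)).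
    apply: le_trans T; rewrite le_eqVlt; apply/orP; left; apply/eqP; congr `| _ |.
    by field; rewrite gt_eqF.
  rewrite normrN !normrM normfV (gtr0_norm t0).
  rewrite (_ : 3 * normal_peak 1 * _ = 3 * normal_peak 1 * `|b| ^+ 3 * (t^-1 ^+ 3 * `|y| ^+ 3)); last by ring.
  rewrite (_ : 3 * normal_peak 1 * eta^-1 ^+ 3 * _ * _ = 3 * normal_peak 1 * `|b| ^+ 3 * (eta^-1 ^+ 3 * (1 + y ^+ 2) ^+ 4)); last by ring.
  apply: ler_wpM2l; first by nneg.
  apply: ler_pM; rewrite ?exprn_ge0 ?invr_ge0 ?(ltW t0)//.
    by rewrite lerXn2r ?nnegrE ?invr_ge0 ?(ltW t0) ?(ltW eta0)// lef_pV2// posrE.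
  exact: poly_growth_le.
- by rewrite le_eqVlt; apply/orP; left; apply/eqP; ring.
Qed.

(* One Lindeberg step: the centered summand a (v^2 - N) + b v has variance
   2 a^2 N^2 + b^2 N, which is added to the squared scale t^2. *)
Lemma lindeberg_step (R : realType) (N eta : R) : 0 < N -> 0 < eta -> exists2 C, 0 <= C &
  forall x s a b t, eta <= t ->
  `|\int[normal_prob x (Num.sqrt N)]_y
       G ((s - (a * ((y - x) ^+ 2 - N) + b * (y - x))) / t)
    - G (s / Num.sqrt (t ^+ 2 + (2 * a ^+ 2 * N ^+ 2 + b ^+ 2 * N)))|
   <= C * (`|a| ^+ 3 + `|a| * b ^+ 2 + a ^+ 2 * `|b|).
Proof.
move=> N0 eta0; have [M M0 HM] := integral_near_quartic N0.
have [C1 C10 HC1] := G_smooth_taylor N0 eta0.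
have p0 := @normal_peak_gt0 R 1 (oner_neq0 _).
pose K : R := 3 * normal_peak 1.
have K0 : 0 <= K :> R by rewrite /K; nneg.
pose k := eta^-1; have k0 : 0 <= k by rewrite /k; nneg.
(* The variance of a (v^2 - N) is 2 a^2 N^2 = (a r2)^2 N, so this part is traded for Gaussian noise
   with coefficient a r2, which turns t into the scale t' below. *)
pose r2 := Num.sqrt (2 * N); have r20 : 0 <= r2 by exact: sqrtr_ge0.
pose W1 := 1 + N; have W10 : 0 <= W1 by rewrite /W1; nneg.
pose W2 := (W1 ^+ 2 + 2 * N ^+ 2) / 2; have W20 : 0 <= W2 by rewrite /W2; nneg.
pose C := K * (k * W1) ^+ 3 + C1 * r2 ^+ 3 + K * k ^+ 3 * W1 + K * k ^+ 3 * W2.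
have C0 : 0 <= C by rewrite /C; nneg.
exists (C * M); first by nneg.
move=> x s a b t et; have t0 : 0 < t by exact: lt_le_trans et.
have tk : t^-1 <= k by rewrite /k lef_pV2// posrE.
have tN0 : t != 0 by rewrite gt_eqF.
have ti0 : 0 <= t^-1 by nneg.
pose t' := Num.sqrt (t ^+ 2 + (a * r2) ^+ 2 * N).
have t'0 : 0 < t' by rewrite sqrtr_gt0 sqrD_gt0// ltW.
have r2E : r2 ^+ 2 = 2 * N by rewrite sqr_sqrtr//; nneg.
set X := `|a| ^+ 3 + _ + _.
have X0 : 0 <= X by rewrite /X; nneg.
pose p := phi (s / t); pose q := s / t * phi (s / t).
pose A := a * p / t; pose B := a * b * q / t ^+ 2; pose D := a ^+ 2 * q / (2 * t ^+ 2).
(* The second term averages exactly to the target, so the mean of f is the error. Both terms contain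
   b (y - x), which is why no |b|^3 arises. *)
pose f (y : R) := G ((s - (a * ((y - x) ^+ 2 - N) + b * (y - x))) / t) - G ((s - b * (y - x)) / t').
have mlin (c : R) : measurable_fun setT (fun y : R => s - c * (y - x)).
  by apply: measurable_funB => //; apply: measurable_funM => //; exact: measurable_funB.
have m1 : measurable_fun setT (fun y : R => G ((s - (a * ((y - x) ^+ 2 - N) + b * (y - x))) / t)).
  apply: (measurableT_comp (@measurable_G R)).
  apply: measurable_funM => //; apply: measurable_funB => //; apply: measurable_funD.
    apply: measurable_funM => //; apply: measurable_funB => //; apply: measurable_funX.
    exact: measurable_funB.
  by apply: measurable_funM => //; exact: measurable_funB.
have m2 : measurable_fun setT (fun y : R => G ((s - b * (y - x)) / t')).
  by apply: (measurableT_comp (@measurable_G R)); apply: measurable_funM.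
have iG (g : R -> R) : measurable_fun setT (fun y : R => G (g y)) ->
    (normal_prob x (Num.sqrt N)).-integrable setT (EFin \o (fun y : R => G (g y))).
  move=> mg; apply: (@integrable_poly_growth _ _ x 1) => // y.
  rewrite ger0_norm ?G_ge0// mul1r (le_trans (G_le1 _))//.
  by rewrite exprn_ege1// lerDl sqr_ge0.
(* With w = v^2 - N the polynomial is - A w - B v w - D (w^2 - 2 N^2). Its mean is 0, since w is
   centered, uncorrelated with v and of variance 2 N^2. *)
have := HM x (A * N + D * N ^+ 2) (B * N) (- A + 2 * D * N) (- B) (- D) (C * X) f _ _ _.
have -> : A * N + D * N ^+ 2 + (- A + 2 * D * N) * N + - D * (3 * N ^+ 2) = 0 by ring.
rewrite subr0 RintegralB//; [|exact: iG|exact: iG].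
rewrite [X in _ - X](Rintegral_G_affine x b s N0 t'0).
have -> : t' ^+ 2 + b ^+ 2 * N = t ^+ 2 + (2 * a ^+ 2 * N ^+ 2 + b ^+ 2 * N).
  rewrite sqr_sqrtr; last by rewrite ltW// sqrD_gt0// ltW.
  by rewrite exprMn r2E; ring.
rewrite (mulrAC C M X); apply.
- exact: measurable_funB.
- by nneg.
move=> y; cbv zeta; set v := y - x.
pose w := v ^+ 2 - N; pose Q := 1 + v ^+ 2; pose s' := s - b * v.
have Q1 : 1 <= Q by rewrite lerDl sqr_ge0.
have Q0 : 0 <= Q by exact: le_trans Q1.
have vQ : `|v| <= Q.
  have := normr_ge0 v; have vE : v ^+ 2 = `|v| ^+ 2 by rewrite real_normK ?num_real.
  by rewrite /Q vE; nra.
have v2Q : v ^+ 2 <= Q by rewrite lerDr.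
have wQ : `|w| <= W1 * Q.
  rewrite (le_trans (ler_normB _ _))// (gtr0_norm N0) ger0_norm ?sqr_ge0//.
  by rewrite /W1 /Q; have := sqr_ge0 v; nra.
have QX j : (j <= 4)%N -> Q ^+ j <= Q ^+ 4 by move=> j4; rewrite ler_weXn2l.
(* [T1] expands in the quadratic part at s' / t, and [T2] is the change of scale there. [T3] and
   [T4] transport phi z and z phi z from s' / t to s / t, so that the coefficients of the polynomial
   do not depend on y. *)
pose T1 := G (s' / t + - (a * w / t)) - G (s' / t) - (- (a * w / t)) * phi (s' / t)
   + (- (a * w / t)) ^+ 2 / 2 * (s' / t * phi (s' / t)).
pose T2 := G (s' / t') - G (s' / t) + (a * r2) ^+ 2 * N / (2 * t ^+ 2) * (s' / t * phi (s' / t)).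
pose T3 := phi (s / t + - (b * v / t)) - phi (s / t) + (- (b * v / t)) * (s / t * phi (s / t)).
pose T4 := (s / t + - (b * v / t)) * phi (s / t + - (b * v / t)) - s / t * phi (s / t).
have s'E : s' / t = s / t + - (b * v / t) by rewrite /s'; field.
have -> : f y - (A * N + D * N ^+ 2 + B * N * v + (- A + 2 * D * N) * v ^+ 2 +
    - B * v ^+ 3 + - D * v ^+ 4) =
  T1 - T2 - (a * w / t) * T3 - (a ^+ 2 * (w ^+ 2 - 2 * N ^+ 2) / (2 * t ^+ 2)) * T4.
  rewrite /f -/v -/w -/s'.
  have -> : (s - (a * w + b * v)) / t = s' / t + - (a * w / t) by rewrite /s'; field.
  rewrite /T1 /T2 exprMn r2E s'E /T3 /T4 /A /B /D /q /p.
  move: (G _) (G _) (G _) (phi (_ + _)) (phi _) => g1 g2 g3 f1 f2.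
  by rewrite /w; field.
have b1 : `|T1| <= K * (k * W1) ^+ 3 * (X * Q ^+ 4).
  apply: le_trans (G_taylor2 _ _) _; rewrite -/K normrN -[leRHS]mulrA ler_wpM2l//.
  rewrite !normrM (ger0_norm ti0) !exprMn.
  apply: (@le_trans _ _ (`|a| ^+ 3 * (W1 * Q) ^+ 3 * k ^+ 3)).
    apply: ler_pM; rewrite ?mulr_ge0 ?exprn_ge0//.
      by rewrite ler_wpM2l ?exprn_ge0// lerXn2r ?nnegrE ?mulr_ge0.
    by rewrite lerXn2r ?nnegrE.
  rewrite exprMn (_ : _ * _ = k ^+ 3 * W1 ^+ 3 * (`|a| ^+ 3 * Q ^+ 3)); last by ring.
  rewrite ler_wpM2l ?mulr_ge0 ?exprn_ge0// ler_pM ?exprn_ge0//; last exact: QX.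
  by rewrite /X -addrA lerDl; nneg.
have b2 : `|T2| <= C1 * r2 ^+ 3 * (X * Q ^+ 4).
  apply: le_trans (HC1 s' _ _ et) _; rewrite normrM (ger0_norm r20) exprMn.
  rewrite -[leRHS]mulrA ler_wpM2l// mulrC ler_wpM2l ?exprn_ge0//.
  rewrite -[leLHS]mulr1 ler_pM ?exprn_ge0//; last by rewrite exprn_ege1.
  by rewrite /X -addrA lerDl; nneg.
have nb : `|- (b * v / t)| <= k * (`|b| * Q).
  by rewrite normrN !normrM (ger0_norm ti0) mulrC ler_pM ?mulr_ge0// ler_wpM2l.
have na : `|a * w / t| <= k * (`|a| * (W1 * Q)).
  by rewrite !normrM (ger0_norm ti0) mulrC ler_pM ?mulr_ge0// ler_wpM2l.
have b3 : `|a * w / t * T3| <= K * k ^+ 3 * W1 * (X * Q ^+ 4).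
  have T3b : `|T3| <= K * (k * (`|b| * Q)) ^+ 2.
    apply: le_trans (phi_taylor1 _ _) _; rewrite -/K ler_wpM2l//.
    by rewrite lerXn2r ?nnegrE//; nneg.
  apply: le_trans (ler_normM_bound na T3b) _.
  rewrite (_ : _ * _ = K * k ^+ 3 * W1 * (`|a| * `|b| ^+ 2 * Q ^+ 3)); last by ring.
  apply: ler_wpM2l; first by nneg.
  rewrite (real_normK (num_real b)).
  apply: ler_pM; [by nneg|by nneg| |exact: QX].
  by rewrite /X addrAC lerDr; nneg.
have b4 : `|a ^+ 2 * (w ^+ 2 - 2 * N ^+ 2) / (2 * t ^+ 2) * T4| <= K * k ^+ 3 * W2 * (X * Q ^+ 4).
  have T4b : `|T4| <= K * (k * (`|b| * Q)).
    by apply: le_trans (xphi_lip _ _) _; rewrite -/K ler_wpM2l.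
  have u1 : `|(w ^+ 2 - 2 * N ^+ 2) / 2| <= W2 * Q ^+ 2.
    have w2 : w ^+ 2 <= W1 ^+ 2 * Q ^+ 2.
      by rewrite -exprMn -(real_normK (num_real w)) lerXn2r ?nnegrE ?mulr_ge0.
    have N2 : 2 * N ^+ 2 <= 2 * N ^+ 2 * Q ^+ 2.
      by rewrite -[leLHS]mulr1 ler_wpM2l ?exprn_ege1//; nneg.
    rewrite normrM [X in _ * X]ger0_norm// /W2 mulrAC ler_wpM2r//.
    rewrite (le_trans (ler_normB _ _))// !ger0_norm; [|by nneg|by nneg].
    by rewrite [leRHS]mulrDl; apply: lerD.
  have u2 : `|a ^+ 2 * (w ^+ 2 - 2 * N ^+ 2) / (2 * t ^+ 2)| <= a ^+ 2 * k ^+ 2 * (W2 * Q ^+ 2).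
    rewrite (_ : _ / _ = a ^+ 2 * t^-1 ^+ 2 * ((w ^+ 2 - 2 * N ^+ 2) / 2)); last by field.
    apply: ler_normM_bound => //.
    rewrite ger0_norm; last by nneg.
    by rewrite ler_wpM2l ?sqr_ge0// lerXn2r ?nnegrE.
  apply: le_trans (ler_normM_bound u2 T4b) _.
  rewrite (_ : _ * _ = K * k ^+ 3 * W2 * (a ^+ 2 * `|b| * Q ^+ 3)); last by ring.
  apply: ler_wpM2l; first by nneg.
  apply: ler_pM; [by nneg|by nneg| |exact: QX].
  by rewrite /X lerDr; nneg.
rewrite -/Q -(mulrA C) /C [leRHS]mulrDl [X in _ <= X + _]mulrDl [X in _ <= X + _ + _]mulrDl.
apply: le_trans (ler_normB _ _) _; apply: lerD => //.
apply: le_trans (ler_normB _ _) _; apply: lerD => //.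
by apply: le_trans (ler_normB _ _) _; apply: lerD.
Qed.

(** * Product measures on tuples *)

Definition cons_pair {T : Type} n (z : T * n.-tuple T) : n.+1.-tuple T := cons_tuple z.1 z.2.

Lemma measurable_cons_pair d (T : measurableType d) n :
  measurable_fun setT (@cons_pair T n).
Proof. by apply: measurable_cons. Qed.

HB.instance Definition _ d (T : measurableType d) n :=
  isMeasurableFun.Build _ _ _ _ (@cons_pair T n) (@measurable_cons_pair d T n).

Section iprod.
Context d (T : measurableType d) (R : realType) (I : Type).
Variable m : I -> probability T R.

(** Bundled as a probability, unlike [Wn]. The letters index a family m, so the channel and, for
    constant m, the i.i.d. laws of inputs and outputs are instances. *)
Fixpoint iprod n : n.-tuple I -> probability (n.-tuple T) R :=
  match n with
  | 0 => fun _ => [the probability _ _ of \d_ [tuple]]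
  | n'.+1 => fun x => [the probability _ _ of
      distribution (m (thead x) \x @iprod n' [tuple of behead x])%E (@cons_pair T n')]
  end.
End iprod.

Lemma ge0_integral_iprodS d (T : measurableType d) (R : realType) (I : Type)
    (m : I -> probability T R) n (x : n.+1.-tuple I) (f : n.+1.-tuple T -> \bar R) :
  measurable_fun setT f -> (forall y, 0 <= f y)%E ->
  (\int[iprod m x]_y f y =
   \int[m (thead x)]_y \int[iprod m [tuple of behead x]]_t f (cons_tuple y t))%E.
Proof.
move=> mf f0.
rewrite [LHS]ge0_integral_distribution// fubini_tonelli1//.
- by apply: measurableT_comp => //; exact: measurable_cons_pair.
- by move=> z; exact: f0.
Qed.

Lemma measurable_cons_slice d (T : measurableType d) n (D : set (n.+1.-tuple T)) y :
  measurable D -> measurable [set t : n.-tuple T | D (cons_tuple y t)].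
Proof.
move=> mD; rewrite -[X in measurable X]setTI.
have : measurable_fun setT (fun t : n.-tuple T => cons_tuple y t) by apply: measurable_cons.
exact.
Qed.

Lemma iprodSE d (T : measurableType d) (R : realType) (I : Type)
    (m : I -> probability T R) n (x : n.+1.-tuple I) (D : set (n.+1.-tuple T)) :
  iprod m x D =
   (\int[m (thead x)]_y iprod m [tuple of behead x] [set t | D (cons_tuple y t)])%E.
Proof.
rewrite /= /distribution /pushforward /product_measure1 /=.
apply: eq_integral => y _; congr (iprod _ _ _).
by apply/seteqP; split => t /=; rewrite /xsection /= inE.
Qed.

Lemma measurable_idR (R : realType) :
  measurable_fun [set: g_sigma_algebraType (R.-ocitv.-measurable)] (fun x => x : R).
Proof. by move=> _ Y mY; rewrite setTI; exact: mY. Qed.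

(* [normal_prob] is a measure on the type [g_sigma_algebraType (R.-ocitv.-measurable)];
   the integrals in [Wn] range over [R] itself. *)
Definition gauss (R : realType) (N x : R) : set R -> \bar R := normal_prob x (Num.sqrt N).

Lemma gauss0 (R : realType) (N x : R) : gauss N x set0 = 0%E.
Proof. exact: (measure0 (normal_prob x (Num.sqrt N))). Qed.

Lemma gauss_ge0 (R : realType) (N x : R) A : (0 <= gauss N x A)%E.
Proof. exact: (measure_ge0 (normal_prob x (Num.sqrt N))). Qed.

Lemma gauss_additive (R : realType) (N x : R) : semi_sigma_additive (gauss N x).
Proof. exact: (@measure_semi_sigma_additive _ _ _ (normal_prob x (Num.sqrt N))). Qed.

HB.instance Definition _ (R : realType) (N x : R) :=
  isMeasure.Build _ R R (gauss N x) (gauss0 N x) (gauss_ge0 N x) (@gauss_additive R N x).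

Lemma gauss_setT (R : realType) (N x : R) : gauss N x setT = 1%E.
Proof. exact: (probability_setT (normal_prob x (Num.sqrt N))). Qed.

HB.instance Definition _ (R : realType) (N x : R) :=
  Measure_isProbability.Build _ R R (gauss N x) (gauss_setT N x).

Lemma ge0_integral_gauss (R : realType) (N x : R) (f : R -> \bar R) :
  measurable_fun setT f -> (forall y, 0 <= f y)%E ->
  (\int[gauss N x]_y f y = \int[normal_prob x (Num.sqrt N)]_y f y)%E.
Proof.
move=> mf f0.
exact: (@ge0_integral_pushforward _ _ (g_sigma_algebraType (R.-ocitv.-measurable)) R R _
  (@measurable_idR R) (normal_prob x (Num.sqrt N)) setT f measurableT mf (fun y _ => f0 y)).
Qed.

Lemma WnE (R : realType) (N : R) n (x : n.-tuple R) (D : set (n.-tuple R)) :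
  measurable D -> Wn N x D = iprod (gauss N) x D.
Proof.
elim: n x D => [|n IH] x D mD; first by [].
rewrite iprodSE.
have E : (fun y => Wn N [tuple of behead x] [set t | D (cons_tuple y t)]) =
   (fun y => iprod (gauss N) [tuple of behead x] [set t | D (cons_tuple y t)]).
  by apply/funext => y; apply: IH; exact: measurable_cons_slice.
have -> : Wn N x D = (\int[gauss N (thead x)]_y
  (Wn N [tuple of behead x] [set t | D (cons_tuple y t)] : \bar R))%E by [].
by rewrite E.
Qed.

Definition tprod {A B : Type} {R : realType} (w : A -> B -> R) n (x : n.-tuple A) (y : n.-tuple B) : R :=
  \prod_(i < n) w (tnth x i) (tnth y i).

Lemma tprodS {A B : Type} {R : realType} (w : A -> B -> R) n (x : n.+1.-tuple A) y (t : n.-tuple B) :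
  tprod w x (cons_tuple y t) = w (thead x) y * tprod w [tuple of behead x] t.
Proof.
rewrite /tprod big_ord_recl; congr (_ * _).
apply: eq_bigr => i _; congr (w _ _).
  by rewrite tnth_behead; congr tnth; apply/val_inj; rewrite /= inordK// ltnS.
by rewrite (tnth_nth y) /= (tnth_nth y).
Qed.

(** Densities multiply: the induction hypothesis changes the measure on the tail,
    [ge0_integral_density] on the head. *)
Lemma iprod_density d (T : measurableType d) (R : realType) (I : Type)
    (m m' : I -> probability T R) (w : I -> T -> R) :
  (forall i, measurable_fun setT (w i)) -> (forall i y, 0 <= w i y) ->
  (forall i A, measurable A -> m i A = \int[m' i]_(y in A) (w i y)%:E)%E ->
  forall n (x : n.-tuple I) (f : n.-tuple T -> \bar R),
  measurable_fun setT f -> (forall y, 0 <= f y)%E ->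
  (\int[iprod m x]_y f y = \int[iprod m' x]_y (f y * (tprod w x y)%:E))%E.
Proof.
move=> mw w0 mE.
have w0' n x y : 0 <= @tprod _ _ _ w n x y by apply: prodr_ge0.
have mw' n x : measurable_fun setT (@tprod _ _ _ w n x).
  rewrite /tprod; apply: measurable_prod => i _.
  by apply: (measurableT_comp (mw _)); exact: measurable_tnth.
elim=> [|n IH] x f mf f0.
  by apply: eq_integral => y _; rewrite /tprod big_ord0 mule1.
have mcons y : measurable_fun setT (fun t : n.-tuple T => cons_tuple y t) by apply: measurable_cons.
rewrite [LHS]ge0_integral_iprodS// [RHS]ge0_integral_iprodS//; last 2 first.
  - by apply: emeasurable_funM; [exact: mf|apply/measurable_EFinP; exact: mw'].
  - by move=> y; rewrite mule_ge0// lee_fin.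
transitivity (\int[m (thead x)]_y \int[iprod m' [tuple of behead x]]_t
    (f (cons_tuple y t) * (tprod w [tuple of behead x] t)%:E))%E.
  apply: eq_integral => y _; apply: (IH _ (fun t => f (cons_tuple y t))) => //.
  exact: (measurableT_comp mf (mcons y)).
rewrite (ge0_integral_density (mu := m' (thead x)) (g := w (thead x)))//.
- apply: eq_integral => y _; rewrite -ge0_integralZr//.
  + by apply: eq_integral => t _; rewrite tprodS EFinM -!muleA [X in (_ * X)%E]muleC.
  + apply: emeasurable_funM; last by apply/measurable_EFinP; exact: mw'.
    exact: (measurableT_comp mf).
  + by move=> t _; rewrite mule_ge0// lee_fin.
  + by rewrite lee_fin.
- exact: mE.
- apply: (@measurable_fun_fubini_tonelli_F _ _ _ _ _ (iprod m' [tuple of behead x])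
    (fun z => f (cons_tuple z.1 z.2) * (tprod w [tuple of behead x] z.2)%:E)%E).
    apply: emeasurable_funM.
      by apply: measurableT_comp => //; exact: measurable_cons_pair.
    by apply/measurable_EFinP; apply: measurableT_comp => //; exact: mw'.
  by move=> z; rewrite mule_ge0// lee_fin.
- by move=> y; apply: integral_ge0 => t _; rewrite mule_ge0// lee_fin.
Qed.

Lemma iprod_cst d (T : measurableType d) (R : realType) (I : Type)
    (p : probability T R) n (x x' : n.-tuple I) (D : set (n.-tuple T)) :
  iprod (fun _ => p) x D = iprod (fun _ => p) x' D.
Proof.
elim: n x x' D => [//|n IH] x x' D; rewrite !iprodSE.
by apply: eq_integral => y _; exact: IH.
Qed.

(** * Central limit theorem for quadratic forms *)

Lemma sqrt_ge_abs (R : realType) (eta v : R) : 0 < eta -> 0 <= v -> eta <= Num.sqrt (eta ^+ 2 + v).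
Proof.
move=> e0 v0; rewrite -[leLHS](gtr0_norm e0) -sqrtr_sqr ler_wsqrtr// lerDl//.
Qed.

(** G x + G (- x) has derivative zero, and its constant value is read off at infinity. *)
Lemma G_opp (R : realType) (x : R) : G (- x) = 1 - G x.
Proof.
pose f (x : R) := G x + G (- x).
have fd (y : R) : is_derive y 1 f 0.
  have D1 := is_derive_G y.
  have D2 : is_derive y 1 (fun y : R => G (- y)) (- phi y).
    have D := is_derive_G (- y).
    apply: (@is_derive_eq _ _ _ _ _ _ _ _ (@is_derive1_comp _ _ _ _ _ _ D _)).
    by rewrite mulrN1 !phiE sqrrN.
  by apply: is_derive_eq; rewrite subrr.
have cf : continuous f.
  by move=> y; apply/differentiable_continuous/derivable1_diffP; exact: (@ex_derive _ _ _ _ _ _ _ (fd y)).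
have fcst a b : a < b -> f a = f b.
  move=> ab; have [c _] := @MVT _ f (fun=> 0) a b ab (fun y _ => fd y) (continuous_subspaceT cf).
  by rewrite mul0r => /eqP; rewrite subr_eq0 => /eqP.
suff : f x = 1 by rewrite /f => <-; rewrite addrAC subrr add0r.
apply/eqP; rewrite -subr_eq0 -normr_le0; apply/ler_addgt0Pl => e e0; rewrite addr0.
have [M HM] := G_cvgy e0; have [M' HM'] := @G_cvgNy R e e0.
pose b := Num.max (x + 1) (Num.max M (- M')).
have b1 : x < b by rewrite lt_max ltrDl ltr01.
have b2 : M <= b by rewrite !le_max lexx orbT.
have b3 : - b <= M' by rewrite lerNl !le_max lexx !orbT.
rewrite (fcst _ _ b1) /f.
have := HM _ b2; have := HM' _ b3; have := G_le1 b; have := G_ge0 (- b).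
by move=> h1 h2 h3 h4; rewrite ler_norml; lra.
Qed.

(** The information density minus its mean under W_x has this shape, by [info_quadsum]. *)
Definition quadsum {R : realType} (N a b : R) n (x y : n.-tuple R) : R :=
  \sum_(i < n) (a * ((tnth y i - tnth x i) ^+ 2 - N) + b * tnth x i * (tnth y i - tnth x i)).

Definition sumsq {R : realType} n (x : n.-tuple R) : R := \sum_(i < n) tnth x i ^+ 2.
Definition sumabs {R : realType} n (x : n.-tuple R) : R := \sum_(i < n) `|tnth x i|.

Lemma thead_sum {R : realType} (f : R -> R) n (x : n.+1.-tuple R) :
  \sum_(i < n.+1) f (tnth x i) = f (thead x) + \sum_(i < n) f (tnth [tuple of behead x] i).
Proof.
rewrite big_ord_recl; congr (_ + _); apply: eq_bigr => i _; congr f.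
by rewrite tnth_behead; congr tnth; apply/val_inj; rewrite /= inordK// ltnS.
Qed.

Lemma sumsq_ge0 {R : realType} n (x : n.-tuple R) : 0 <= sumsq x.
Proof. by apply: sumr_ge0 => i _; exact: sqr_ge0. Qed.

Lemma sumabs_ge0 {R : realType} n (x : n.-tuple R) : 0 <= sumabs x.
Proof. by apply: sumr_ge0. Qed.

Lemma sumabs_le {R : realType} n (x : n.-tuple R) : sumabs x <= n%:R + sumsq x.
Proof.
rewrite /sumabs /sumsq -[n in n%:R]card_ord -sumr_const -big_split/=.
apply: ler_sum => i _; have := normr_ge0 (tnth x i).
rewrite -(real_normK (num_real (tnth x i))); nra.
Qed.

Lemma quadsumS {R : realType} (N a b : R) n (x : n.+1.-tuple R) y (t : n.-tuple R) :
  quadsum N a b x (cons_tuple y t) =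
  a * ((y - thead x) ^+ 2 - N) + b * thead x * (y - thead x) + quadsum N a b [tuple of behead x] t.
Proof.
rewrite /quadsum big_ord_recl; congr (_ + _).
apply: eq_bigr => i _.
have -> : tnth (cons_tuple y t) (lift ord0 i) = tnth t i by rewrite (tnth_nth y) /= (tnth_nth y).
have -> : tnth x (lift ord0 i) = tnth [tuple of behead x] i.
  by rewrite tnth_behead; congr tnth; apply/val_inj; rewrite /= inordK// ltnS.
by [].
Qed.

Lemma measurable_quadsum {R : realType} (N a b : R) n (x : n.-tuple R) :
  measurable_fun setT (quadsum N a b x).
Proof.
have mt i : measurable_fun setT (fun y : n.-tuple R => tnth y i - tnth x i).
  by apply: measurable_funB => //; exact: measurable_tnth.
apply: measurable_sum => i; apply: measurable_funD.
  apply: measurable_funM => //; apply: measurable_funB => //; exact: measurable_funX.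
exact: measurable_funM.
Qed.

Lemma measurable_quadsum_le {R : realType} (N a b s c : R) n (x : n.-tuple R) :
  measurable [set y : n.-tuple R | s + quadsum N a b x y <= c].
Proof.
have mf : measurable_fun setT (fun y : n.-tuple R => s + quadsum N a b x y).
  by apply: measurable_funD => //; exact: measurable_quadsum.
have := mf measurableT `]-oo, c]%classic (measurable_itv _); rewrite setTI.
by rewrite (_ : _ @^-1` _ = [set y | s + quadsum N a b x y <= c])//; apply/seteqP; split => y /=; rewrite in_itv.
Qed.

Lemma measurable_iprod_slice d (T : measurableType d) (R : realType) (I : Type)
    (m : I -> probability T R) n (x : n.-tuple I) (D : set (n.+1.-tuple T)) :
  measurable D -> measurable_fun setT (fun y => iprod m x [set t | D (cons_tuple y t)]).
Proof.
move=> mD.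
have mD' : measurable (@cons_pair T n @^-1` D).
  by rewrite -[X in measurable X]setTI; exact: measurable_cons_pair.
have := measurable_fun_xsection (iprod m x) mD'.
congr measurable_fun; apply/funext => y; congr (iprod _ _ _).
by apply/seteqP; split => t /=; rewrite /xsection /= inE.
Qed.

Lemma integrable_normal_bounded (R : realType) (N x B : R) (h : R -> R) : 0 < N ->
  measurable_fun setT h -> (forall y, `|h y| <= B) ->
  (normal_prob x (Num.sqrt N)).-integrable setT (EFin \o h).
Proof.
move=> N0 mh hB; apply: (@integrable_poly_growth _ _ x B) => // y.
rewrite (le_trans (hB y))// ler_peMr ?(le_trans _ (hB y))//.
by rewrite exprn_ege1// lerDl sqr_ge0.
Qed.

Lemma integral_gauss_bounded (R : realType) (N x B : R) (h : R -> R) : 0 < N ->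
  measurable_fun setT h -> (forall y, 0 <= h y <= B) ->
  (\int[gauss N x]_y (h y)%:E = (\int[normal_prob x (Num.sqrt N)]_y h y)%:E)%E.
Proof.
move=> N0 mh hB; rewrite ge0_integral_gauss; last 2 first.
  exact/measurable_EFinP.
  by move=> y; rewrite lee_fin; case/andP: (hB y).
rewrite /Rintegral fineK//; apply: integrable_fin_num => //.
by apply: (@integrable_normal_bounded _ _ _ B) => // y; rewrite ger0_norm; case/andP: (hB y).
Qed.

(* The term 1 - G(delta / eta) is the cost of replacing an indicator function by G with scale eta. *)
Lemma quadsum_clt_upper (R : realType) (N eta delta : R) : 0 < N -> 0 < eta -> 0 < delta ->
  exists2 C, 0 <= C & forall n (x : n.-tuple R) (a b s c : R),
  (iprod (gauss N) x [set y | (s + quadsum N a b x y <= c)%R] <=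
  (G ((c + delta - s) / Num.sqrt (eta ^+ 2 + (n%:R * (2 * a ^+ 2 * N ^+ 2) + b ^+ 2 * N * sumsq x)))
   + (1 - G (delta / eta))
   + C * (n%:R * `|a| ^+ 3 + `|a| * b ^+ 2 * sumsq x + a ^+ 2 * `|b| * sumabs x))%:E)%E.
Proof.
move=> N0 eta0 delta0; have [C C0 HC] := lindeberg_step N0 eta0.
(* The start value s is generalized: the induction removes the first coordinate and adds its summand
   to s. *)
exists C => // n x a b; elim: n x => [|n IH] x s c.
  rewrite /quadsum /sumsq /sumabs !big_ord0 !mulr0 !mul0r !addr0 mulr0 addr0.
  rewrite sqrtr_sqr gtr0_norm// /= diracE lee_fin.
  have Gd : 0 <= 1 - G (delta / eta) by rewrite subr_ge0 G_le1.
  case: (boolP (_ \in _)); last by move=> _; rewrite addr_ge0// G_ge0.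
  rewrite inE /quadsum/= big_ord0 addr0 => sc.
  (* With no coordinate left the probability is the indicator of s <= c, and s <= c makes the
     argument of [G] at least delta / eta. *)
  have : G (delta / eta) <= G ((c + delta - s) / eta).
    by rewrite G_mono ler_pM2r ?invr_gt0//; lra.
  by rewrite /=; lra.
rewrite iprodSE.
set vx := sumsq [tuple of behead x]; set ax := sumabs [tuple of behead x].
have sE : sumsq x = thead x ^+ 2 + vx by exact: (thead_sum (fun z => z ^+ 2)).
have aE : sumabs x = `|thead x| + ax by exact: (thead_sum (fun z => `|z|)).
pose v' := n%:R * (2 * a ^+ 2 * N ^+ 2) + b ^+ 2 * N * vx.
have v'0 : 0 <= v'.
  by rewrite /v'; have := sumsq_ge0 [tuple of behead x]; rewrite -/vx => ?; nneg.
pose t' := Num.sqrt (eta ^+ 2 + v').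
have t'eta : eta <= t' by exact: sqrt_ge_abs.
have t'0 : 0 < t' by exact: lt_le_trans t'eta.
pose e' := n%:R * `|a| ^+ 3 + `|a| * b ^+ 2 * vx + a ^+ 2 * `|b| * ax.
have e'0 : 0 <= e'.
  rewrite /e'; have := sumsq_ge0 [tuple of behead x]; have := sumabs_ge0 [tuple of behead x].
  by rewrite -/vx -/ax => ? ?; nneg.
pose k := (1 - G (delta / eta)) + C * e'.
have k0 : 0 <= k by rewrite addr_ge0 ?mulr_ge0// subr_ge0 G_le1.
pose h (y : R) := G ((c + delta - s - (a * ((y - thead x) ^+ 2 - N) + b * thead x * (y - thead x))) / t').
have mh : measurable_fun setT h.
  apply: (measurableT_comp (@measurable_G R)).
  apply: measurable_funM => //; apply: measurable_funB => //; apply: measurable_funD.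
    apply: measurable_funM => //; apply: measurable_funB => //; apply: measurable_funX.
    exact: measurable_funB.
  by apply: measurable_funM => //; exact: measurable_funB.
have h01 y : 0 <= h y <= 1 by rewrite /h G_ge0 G_le1.
apply: (@le_trans _ _ (\int[gauss N (thead x)]_y (h y + k)%:E)%E).
  apply: ge0_le_integral => //.
  - apply: measurable_iprod_slice; exact: measurable_quadsum_le.
  - by apply/measurable_EFinP; apply: measurable_funD.
  - move=> y _.
    have := IH [tuple of behead x] (s + (a * ((y - thead x) ^+ 2 - N) + b * thead x * (y - thead x))) c.
    rewrite -addrA -/vx -/ax -/v' -/t' -/e' -/k.
    rewrite (_ : c + delta - (s + _) = c + delta - s - (a * ((y - thead x) ^+ 2 - N) + b * thead x * (y - thead x))); last by ring.
    rewrite -/(h y); apply: le_trans.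
    rewrite le_eqVlt; apply/orP; left; apply/eqP; congr (iprod _ _ _).
    apply/funext => t; rewrite /mkset quadsumS; congr (is_true (_ <= _)).
    by rewrite !addrA.
rewrite (@integral_gauss_bounded _ _ _ (1 + k))//; last 2 first.
  exact: measurable_funD.
  by move=> y; case/andP: (h01 y) => h0 h1; rewrite addr_ge0//= lerD2r.
rewrite lee_fin RintegralD//; last 2 first.
  by apply: (@integrable_normal_bounded _ _ _ 1) => // y; rewrite ger0_norm; case/andP: (h01 y).
  by apply: (@integrable_normal_bounded _ _ _ k) => // y; rewrite ger0_norm.
rewrite Rintegral_normal_prob_cst.
have := HC (thead x) (c + delta - s) a (b * thead x) t' t'eta.
rewrite -/(h _).
have -> : t' ^+ 2 + (2 * a ^+ 2 * N ^+ 2 + (b * thead x) ^+ 2 * N) =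
  eta ^+ 2 + (n.+1%:R * (2 * a ^+ 2 * N ^+ 2) + b ^+ 2 * N * sumsq x).
  rewrite sqr_sqrtr; last by rewrite addr_ge0// sqr_ge0.
  by rewrite /v' sE -natr1; ring.
set g := G _; set I := \int[_]_y _ ; rewrite ler_norml => /andP[_ H].
apply: (@le_trans _ _ (g + C * (`|a| ^+ 3 + `|a| * (b * thead x) ^+ 2 + a ^+ 2 * `|b * thead x|) + k)).
  by rewrite lerD2r -lerBlDl.
rewrite le_eqVlt; apply/orP; left; apply/eqP.
by rewrite /k /e' sE aE -natr1 normrM; ring.
Qed.

Lemma quadsum_scale {R : realType} (N a b r : R) n (x y : n.-tuple R) :
  quadsum N (r * a) (r * b) x y = r * quadsum N a b x y.
Proof. by rewrite /quadsum mulr_sumr; apply: eq_bigr => i _; ring. Qed.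

(** Dividing both coefficients by sqrt n keeps the variance of order one and makes the error O(1 /
    sqrt n): on the power ball [sumsq x] <= nS and [sumabs x] <= n (1 + S), whatever the individual
    coordinates. *)
Lemma quadsum_clt_upper_sqrt (R : realType) (N S eta delta al ka : R) :
  0 < N -> 0 < S -> 0 < eta -> 0 < delta ->
  exists2 E, 0 <= E & forall n (x : n.-tuple R) (c : R), (0 < n)%N -> sumsq x <= n%:R * S ->
  fine (iprod (gauss N) x [set y | (quadsum N al ka x y <= c * Num.sqrt n%:R)%R]) <=
  G ((c + delta) / Num.sqrt (eta ^+ 2 + (2 * al ^+ 2 * N ^+ 2 + ka ^+ 2 * N * (sumsq x / n%:R))))
   + (1 - G (delta / eta)) + E / Num.sqrt n%:R.
Proof.
move=> N0 S0 eta0 delta0; have [C C0 HC] := quadsum_clt_upper N0 eta0 delta0.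
exists (C * (`|al| ^+ 3 + `|al| * ka ^+ 2 * S + al ^+ 2 * `|ka| * (1 + S))).
  by nneg.
move=> n x c n0 xS.
have nR : 0 < n%:R :> R by rewrite ltr0n.
set r := Num.sqrt n%:R; have r0 : 0 < r by rewrite sqrtr_gt0.
have r2 : r ^+ 2 = n%:R by rewrite sqr_sqrtr// ltW.
have rN : r != 0 by rewrite gt_eqF.
have := HC n x (r^-1 * al) (r^-1 * ka) 0 c.
have -> : [set y | 0 + quadsum N (r^-1 * al) (r^-1 * ka) x y <= c] =
    [set y | quadsum N al ka x y <= c * r].
  apply/funext => y; rewrite /mkset add0r quadsum_scale; congr is_true.
  by rewrite mulrC ler_pdivrMr.
rewrite -[X in (X <= _)%E]fineK ?fin_num_measure//; last first.
  by have := measurable_quadsum_le N al ka 0 (c * r) x; under eq_set do rewrite add0r.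
rewrite lee_fin => H; apply: le_trans H _; rewrite subr0.
have -> : n%:R * (2 * (r^-1 * al) ^+ 2 * N ^+ 2) + (r^-1 * ka) ^+ 2 * N * sumsq x =
   2 * al ^+ 2 * N ^+ 2 + ka ^+ 2 * N * (sumsq x / n%:R).
  by rewrite -r2; field.
rewrite lerD2l -[leRHS]mulrA ler_wpM2l// !normrM !exprMn normfV (gtr0_norm r0).
have -> : n%:R * (r^-1 ^+ 3 * `|al| ^+ 3) + r^-1 * `|al| * (r^-1 ^+ 2 * ka ^+ 2) * sumsq x +
  r^-1 ^+ 2 * al ^+ 2 * (r^-1 * `|ka|) * sumabs x =
  (n%:R * `|al| ^+ 3 + `|al| * ka ^+ 2 * sumsq x + al ^+ 2 * `|ka| * sumabs x) / r ^+ 2 / r.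
  by field.
rewrite ler_pM2r ?invr_gt0// ler_pdivrMr ?exprn_gt0// r2.
have a1 : sumabs x <= n%:R * (1 + S) by rewrite (le_trans (sumabs_le x))// mulrDr mulr1 lerD2l.
have h1 : `|al| * ka ^+ 2 * sumsq x <= `|al| * ka ^+ 2 * (n%:R * S) by rewrite ler_wpM2l//; nneg.
have h2 : al ^+ 2 * `|ka| * sumabs x <= al ^+ 2 * `|ka| * (n%:R * (1 + S)) by rewrite ler_wpM2l//; nneg.
apply: le_trans (lerD (lerD (lexx _) h1) h2) _.
by rewrite le_eqVlt; apply/orP; left; apply/eqP; ring.
Qed.

Lemma measurable_quadsum_le0 {R : realType} (N a b c : R) n (x : n.-tuple R) :
  measurable [set y : n.-tuple R | quadsum N a b x y <= c].
Proof.
by have := measurable_quadsum_le N a b 0 c x; under eq_set do rewrite add0r.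
Qed.

(* Apply the upper bound to the opposite quadratic form. *)
Lemma quadsum_clt_lower_sqrt (R : realType) (N S eta delta al ka : R) :
  0 < N -> 0 < S -> 0 < eta -> 0 < delta ->
  exists2 E, 0 <= E & forall n (x : n.-tuple R) (c : R), (0 < n)%N -> sumsq x <= n%:R * S ->
  G ((c - delta) / Num.sqrt (eta ^+ 2 + (2 * al ^+ 2 * N ^+ 2 + ka ^+ 2 * N * (sumsq x / n%:R))))
   - (1 - G (delta / eta)) - E / Num.sqrt n%:R <=
  fine (iprod (gauss N) x [set y | (quadsum N al ka x y <= c * Num.sqrt n%:R)%R]).
Proof.
move=> N0 S0 eta0 delta0.
have [E E0 HE] := quadsum_clt_upper_sqrt (- al) (- ka) N0 S0 eta0 delta0.
exists E => // n x c n0 xS; have := HE n x (- c) n0 xS.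
rewrite !sqrrN (_ : - c + delta = - (c - delta)); last by ring.
rewrite [- (c - delta) / _]mulNr G_opp.
set A := iprod _ _ _; set D := [set y | quadsum N al ka x y <= _]; set g := G ((c - delta) / _) => H.
have mD : measurable D by exact: measurable_quadsum_le0.
have sub : 1 - fine (iprod (gauss N) x D) <= fine A.
  rewrite -(_ : fine (iprod (gauss N) x (~` D)) = 1 - fine (iprod (gauss N) x D)); last first.
    by rewrite probability_setC// fineB ?fin_num_measure.
  apply: fine_le.
  - by rewrite fin_num_measure//; exact: measurableC.
  - by rewrite fin_num_measure//; exact: measurable_quadsum_le0.
  apply: le_measure; rewrite ?inE.
  - exact: measurableC.
  - exact: measurable_quadsum_le0.
  - move=> y /=; rewrite /D /= => /negP; rewrite -ltNge => cy.
    rewrite -[- al]mulN1r -[- ka]mulN1r quadsum_scale mulN1r mulNr lerN2.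
    exact: ltW.
lra.
Qed.

(** * Information density *)

Definition idens {R : realType} (N S x y : R) : R :=
  capG N S + (y ^+ 2 / (2 * (N + S)) - (y - x) ^+ 2 / (2 * N)).

Definition info {R : realType} (N S : R) n (x y : n.-tuple R) : R :=
  \sum_(i < n) idens N S (tnth x i) (tnth y i).

Lemma expR_capG (R : realType) (N S : R) : 0 < N -> 0 < S ->
  expR (capG N S) = Num.sqrt (N + S) / Num.sqrt N.
Proof.
move=> N0 S0.
have u0 : 0 < 1 + S / N by rewrite addr_gt0// divr_gt0.
have -> : Num.sqrt (N + S) / Num.sqrt N = Num.sqrt (1 + S / N).
  rewrite -sqrtrV ?ltW// -sqrtrM ?addr_ge0 ?ltW//; congr Num.sqrt.
  by rewrite mulrDl mulfV// gt_eqF.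
rewrite -[LHS]gtr0_norm ?expR_gt0// -sqrtr_sqr -expRM_natl; congr Num.sqrt.
by rewrite /capG mulrA mulfV ?mul1r// lnK// posrE.
Qed.

Lemma idens_density (R : realType) (N S x y : R) : 0 < N -> 0 < S ->
  expR (idens N S x y) * normal_pdf 0 (Num.sqrt (N + S)) y = normal_pdf x (Num.sqrt N) y.
Proof.
move=> N0 S0.
have K0 : 0 < N + S by rewrite addr_gt0.
have sN : 0 < Num.sqrt N by rewrite sqrtr_gt0.
have sK : 0 < Num.sqrt (N + S) by rewrite sqrtr_gt0.
have p0 : 0 < Num.sqrt (2 * pi) :> R by rewrite sqrtr_gt0 mulr_gt0// pi_gt0.
rewrite !normal_pdfE_sqr// !sqr_sqrtr ?ltW// /idens expRD expR_capG// subr0.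
transitivity ((Num.sqrt (2 * pi) * Num.sqrt N)^-1 *
  (expR (y ^+ 2 / (2 * (N + S)) - (y - x) ^+ 2 / (2 * N)) * expR (- y ^+ 2 / (2 * (N + S))))).
  move: (expR _) (expR _) => e1 e2.
  by field; rewrite !gt_eqF.
by rewrite -expRD; congr (_ * expR _); ring.
Qed.

Lemma measurable_idens d (T : measurableType d) (R : realType) (N S : R) (f g : T -> R) :
  measurable_fun setT f -> measurable_fun setT g ->
  measurable_fun setT (fun t => idens N S (f t) (g t)).
Proof.
move=> mf mg.
apply: measurable_funD => //; apply: measurable_funB; apply: measurable_funM => //; apply: measurable_funX => //.
exact: measurable_funB.
Qed.

Lemma gauss_density (R : realType) (N S x : R) (A : set R) : 0 < N -> 0 < S -> measurable A ->
  (gauss N x A = \int[gauss (N + S) 0]_(y in A) (expR (idens N S x y))%:E)%E.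
Proof.
move=> N0 S0 mA.
have mw : measurable_fun setT (fun y : R => expR (idens N S x y)).
  by apply: measurableT_comp => //; exact: measurable_idens.
rewrite integral_mkcond ge0_integral_gauss; last 2 first.
  - apply/(measurable_restrictT _ mA); exact/measurable_EFinP/measurable_funTS.
  - by move=> y; rewrite patchE; case: ifPn => // _; rewrite lee_fin expR_ge0.
rewrite ge0_integral_normal_prob; last 2 first.
  - apply/(measurable_restrictT _ mA); exact/measurable_EFinP/measurable_funTS.
  - by move=> y; rewrite patchE; case: ifPn => // _; rewrite lee_fin expR_ge0.
rewrite /gauss /normal_prob integral_mkcond; apply: eq_integral => y _.
by rewrite !patchE; case: ifPn => _; rewrite ?mul0e// -EFinM idens_density.
Qed.

Lemma tprod_idens (R : realType) (N S : R) n (x y : n.-tuple R) :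
  tprod (fun x y => expR (idens N S x y)) x y = expR (info N S x y).
Proof. by rewrite /tprod /info expR_sum. Qed.

Lemma measurable_info d (T : measurableType d) (R : realType) (N S : R) n (f g : T -> n.-tuple R) :
  measurable_fun setT f -> measurable_fun setT g ->
  measurable_fun setT (fun t => info N S (f t) (g t)).
Proof.
move=> mf mg; apply: measurable_sum => i.
by apply: measurable_idens; apply: (measurableT_comp (measurable_tnth i)).
Qed.

(** Used with K = N + S as the reference output law, and with K = S as the input law. *)
Definition outdist (R : realType) (K : R) n : probability (n.-tuple R) R :=
  iprod (fun _ : R => gauss K 0) (nseq_tuple n 0).

Lemma iprod_info (R : realType) (N S : R) n (x : n.-tuple R) (D : set (n.-tuple R)) :
  0 < N -> 0 < S -> measurable D ->
  (iprod (gauss N) x D = \int[outdist (N + S) n]_(y in D) (expR (info N S x y))%:E)%E.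
Proof.
move=> N0 S0 mD.
transitivity (\int[iprod (gauss N) x]_y (\1_D y)%:E)%E; first by rewrite integral_indic// setIT.
rewrite (@iprod_density _ _ _ _ (gauss N) (fun _ : R => gauss (N + S) 0) (fun x y => expR (idens N S x y))).
- transitivity (\int[outdist (N + S) n]_y ((\1_D y)%:E * (tprod (fun x y => expR (idens N S x y)) x y)%:E))%E.
    by apply: eq_measure_integral => A _ _; exact: iprod_cst.
  rewrite [RHS]integral_mkcond; apply: eq_integral => y _; rewrite patchE tprod_idens indicE.
  by case: ifPn => _; rewrite ?mul1e ?mul0e.
- by move=> i; apply: measurableT_comp => //; exact: measurable_idens.
- by move=> i y; exact: expR_ge0.
- by move=> i A mA; exact: gauss_density.
- by apply/measurable_EFinP; exact: measurable_indic.
- by move=> y; rewrite lee_fin.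
Qed.

Lemma measurable_info_le (R : realType) (N S t : R) n (x : n.-tuple R) :
  measurable [set y : n.-tuple R | info N S x y <= t].
Proof.
have := measurable_info N S (measurable_cst x) (@measurable_id _ (n.-tuple R) setT) measurableT (measurable_itv `]-oo, t]); rewrite setTI.
by rewrite (_ : _ @^-1` _ = [set y | info N S x y <= t])//; apply/seteqP; split => y /=; rewrite in_itv.
Qed.

Lemma iprod_le_expR_outdist (R : realType) (N S t : R) n (x : n.-tuple R) (D : set (n.-tuple R)) :
  0 < N -> 0 < S -> measurable D -> D `<=` [set y | info N S x y <= t] ->
  fine (iprod (gauss N) x D) <= expR t * fine (outdist (N + S) n D).
Proof.
move=> N0 S0 mD Dt.
rewrite -lee_fin EFinM !fineK ?fin_num_measure// (iprod_info x N0 S0 mD) -integral_cst//.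
apply: ge0_le_integral => //.
- by apply/measurable_EFinP; apply: measurable_funTS; apply: measurableT_comp => //; exact: measurable_info.
- by move=> y Dy; rewrite lee_fin ler_expR; exact: Dt.
Qed.

Lemma expR_outdist_le_iprod (R : realType) (N S t : R) n (x : n.-tuple R) (D : set (n.-tuple R)) :
  0 < N -> 0 < S -> measurable D -> D `<=` [set y | t <= info N S x y] ->
  expR t * fine (outdist (N + S) n D) <= fine (iprod (gauss N) x D).
Proof.
move=> N0 S0 mD Dt.
rewrite -lee_fin EFinM !fineK ?fin_num_measure// (iprod_info x N0 S0 mD) -integral_cst//.
apply: ge0_le_integral => //.
- by move=> y _; rewrite lee_fin expR_ge0.
- by apply/measurable_EFinP; apply: measurable_funTS; apply: measurableT_comp => //; exact: measurable_info.
- by move=> y Dy; rewrite lee_fin ler_expR; exact: Dt.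
Qed.

(* Inputs N(0, S) produce outputs N(0, N + S): the density of the output distribution with
   respect to N(0, N + S) is 1. *)
Lemma integral_input_idens (R : realType) (N S y : R) : 0 < N -> 0 < S ->
  (\int[gauss S 0]_x (expR (idens N S x y))%:E = 1)%E.
Proof.
move=> N0 S0.
have sN : 0 < Num.sqrt N by rewrite sqrtr_gt0.
have sS : 0 < Num.sqrt S by rewrite sqrtr_gt0.
have sK : 0 < Num.sqrt (N + S) by rewrite sqrtr_gt0 addr_gt0.
have mw : measurable_fun setT (fun x : R => expR (idens N S x y)).
  by apply: measurableT_comp => //; exact: measurable_idens.
rewrite ge0_integral_gauss; [|exact/measurable_EFinP|by move=> x; rewrite lee_fin expR_ge0].
rewrite ge0_integral_normal_prob; [|exact/measurable_EFinP|by move=> x; rewrite lee_fin expR_ge0].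
have r : Num.sqrt (Num.sqrt N ^+ 2 + 1 ^+ 2 * Num.sqrt S ^+ 2) = Num.sqrt (N + S).
  by rewrite !sqr_sqrtr ?ltW// expr1n mul1r.
rewrite -[RHS](@integral_normal_pdf R (0 + y * 1 * Num.sqrt S ^+ 2 / Num.sqrt (N + S) ^+ 2)
  (Num.sqrt S * Num.sqrt N / Num.sqrt (N + S))).
apply: eq_integral => x _; rewrite -EFinM; congr EFin.
(* Prior N(0, S) and noise of variance N: dividing by the marginal density of the output y leaves
   the posterior density of x. *)
have := normal_pdf_mix 0 1 x y sS sN; rewrite /= r mul1r subr0 => mixE.
have pK : normal_pdf 0 (Num.sqrt (N + S)) y != 0.
  by rewrite normal_pdfE_sqr// gt_eqF// mulr_gt0 ?expR_gt0// invr_gt0 mulr_gt0// sqrtr_gt0 mulr_gt0// pi_gt0.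
by apply: (mulfI pK); rewrite -mixE -(idens_density x y N0 S0); ring.
Qed.

Lemma infoS (R : realType) (N S : R) n x (t : n.-tuple R) (y : n.+1.-tuple R) :
  info N S (cons_tuple x t) y = idens N S x (thead y) + info N S t [tuple of behead y].
Proof.
rewrite /info big_ord_recl; congr (_ + _).
apply: eq_bigr => i _; congr idens.
  by rewrite (tnth_nth x) /= (tnth_nth x).
by rewrite tnth_behead; congr tnth; apply/val_inj; rewrite /= inordK// ltnS.
Qed.

Lemma integral_input_info (R : realType) (N S : R) n (z y : n.-tuple R) : 0 < N -> 0 < S ->
  (\int[iprod (fun _ : R => gauss S 0) z]_x (expR (info N S x y))%:E = 1)%E.
Proof.
move=> N0 S0; elim: n z y => [|n IH] z y.
  rewrite (_ : (fun x => _) = cst 1%E).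
    by rewrite integral_cst// mul1e; exact: probability_setT.
  by apply/funext => x; rewrite /info big_ord0 expR0.
have minfo m (u : m.-tuple R) : measurable_fun setT (fun x => expR (info N S x u)).
  by apply: measurableT_comp => //; exact: measurable_info.
rewrite ge0_integral_iprodS; last 2 first.
  - by apply/measurable_EFinP; exact: (minfo n.+1 y).
  - by move=> x; rewrite lee_fin expR_ge0.
rewrite -[RHS](@integral_input_idens R N S (thead y))//.
apply: eq_integral => x _.
transitivity (\int[iprod (fun _ : R => gauss S 0) [tuple of behead z]]_t
   ((expR (idens N S x (thead y)))%:E * (expR (info N S t [tuple of behead y]))%:E))%E.
  by apply: eq_integral => t _; rewrite infoS expRD EFinM.
rewrite ge0_integralZl//.
- by rewrite IH mule1.
- by apply/measurable_EFinP; exact: (minfo n [tuple of behead y]).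
Qed.

(** The average of W_x(U) over Gaussian inputs x is the output probability of U, by Tonelli and
    [integral_input_info]; the inputs in F alone contribute at least tau each. *)
Lemma outdist_ge_inputs (R : realType) (N S tau : R) n (F U : set (n.-tuple R)) :
  0 < N -> 0 < S -> 0 <= tau -> measurable F -> measurable U ->
  (forall x, F x -> tau <= fine (iprod (gauss N) x U)) ->
  tau * fine (outdist S n F) <= fine (outdist (N + S) n U).
Proof.
move=> N0 S0 tau0 mF mU HF.
rewrite -lee_fin EFinM !fineK ?fin_num_measure//.
pose k (z : n.-tuple R * n.-tuple R) : R := \1_U z.2 * expR (info N S z.1 z.2).
have k0 z : 0 <= k z by rewrite mulr_ge0 ?expR_ge0.
have mk : measurable_fun setT k.
  apply: measurable_funM; last by apply: measurableT_comp => //; exact: measurable_info.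
  by apply: measurableT_comp => //; exact: measurable_indic.
apply: (@le_trans _ _ (\int[outdist S n]_x \int[outdist (N + S) n]_y (k (x, y))%:E)%E).
  have -> : (tau%:E * outdist S n F = \int[outdist S n]_(x in F) tau%:E)%E by rewrite integral_cst.
  rewrite [leLHS]integral_mkcond.
  apply: ge0_le_integral => //.
  - by move=> x _; rewrite patchE; case: ifPn => //; rewrite lee_fin.
  - apply/(measurable_restrictT _ mF); exact: measurable_cst.
  - apply: (@measurable_fun_fubini_tonelli_F _ _ _ _ _ (outdist (N + S) n) (fun z => (k z)%:E)).
      exact/measurable_EFinP.
    by move=> z; rewrite lee_fin.
  - move=> x _; rewrite patchE; case: ifPn => [|_].
      rewrite inE => /HF H.
      apply: (@le_trans _ _ (iprod (gauss N) x U)).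
        by rewrite -(fineK (fin_num_measure _ _ mU)) lee_fin.
      rewrite (iprod_info x N0 S0 mU) integral_mkcond.
      rewrite le_eqVlt; apply/orP; left; apply/eqP; apply: eq_integral => y _.
      by rewrite patchE /k/= indicE; case: ifPn => _; rewrite ?mul1r ?mul0r.
    by apply: integral_ge0 => y _; rewrite lee_fin.
rewrite (tonelli_EFin (outdist S n) (outdist (N + S) n) mk k0).
have -> : outdist (N + S) n U = (\int[outdist (N + S) n]_y (\1_U y)%:E)%E.
  by rewrite integral_indic// setIT.
rewrite le_eqVlt; apply/orP; left; apply/eqP.
apply: eq_integral => y _.
transitivity (\int[outdist S n]_x ((\1_U y)%:E * (expR (info N S x y))%:E))%E.
  by apply: eq_integral => x _; rewrite -EFinM.
rewrite ge0_integralZl//.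
- by rewrite integral_input_info// mule1.
- by apply/measurable_EFinP; apply: measurableT_comp => //; exact: measurable_info.
Qed.

Lemma info_quadsum (R : realType) (N S : R) n (x y : n.-tuple R) : 0 < N -> 0 < S ->
  info N S x y = n%:R * capG N S + quadsum N (- S / (2 * N * (N + S))) (N + S)^-1 x y
    - (n%:R * S - sumsq x) / (2 * (N + S)).
Proof.
move=> N0 S0.
have K0 : N + S != 0 by rewrite gt_eqF// addr_gt0.
have N1 : N != 0 by rewrite gt_eqF.
rewrite -[n in n%:R * capG _ _]card_ord -[n in n%:R * S]card_ord.
rewrite -!sumr_const !mulr_suml /quadsum /sumsq /info.
rewrite -sumrB mulr_suml -big_split/= -sumrB; apply: eq_bigr => i _.
rewrite /idens !mul1r; field.
by rewrite K0 N1.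
Qed.

(** * Converse *)

Lemma sum_dec_le1 (R : realType) n (c : Defs.code R n) (Q : probability (n.-tuple R) R) :
  \sum_(i < code_size c) fine (Q (@dec _ _ c i)) <= 1.
Proof.
have mU : measurable (\big[setU/set0]_(i < code_size c) @dec _ _ c i).
  by apply: bigsetU_measurable => i _; exact: dec_measurable.
have tI : trivIset setT (fun i => @dec _ _ c i).
  apply/trivIsetP => i j _ _ ij; exact: dec_disjoint.
have := @probability_le1 _ _ _ Q _ mU.
rewrite measure_semi_additive_ord//; last by move=> i; exact: dec_measurable.
rewrite -lee_fin -sumEFin; apply: le_trans.
rewrite le_eqVlt; apply/orP; left; apply/eqP; apply: eq_bigr => i _.
by rewrite fineK// fin_num_measure//; exact: dec_measurable.
Qed.

(* Verdu-Han: where i(x, y) <= t, W_x has density at most e^t with respect to Q, and the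
   Q-probabilities of the decoding sets add up to at most 1. *)
Lemma Pe_ge (R : realType) (N S t g : R) n (c : Defs.code R n) : 0 < N -> 0 < S ->
  (forall i, g <= fine (iprod (gauss N) (@enc _ _ c i) [set y | info N S (@enc _ _ c i) y <= t])) ->
  g - expR t / (code_size c)%:R <= Pe N c.
Proof.
move=> N0 S0 Hg.
have M0 : 0 < (code_size c)%:R :> R by rewrite ltr0n code_size_gt0.
set Q := outdist (N + S) n.
have key i : g - expR t * fine (Q (@dec _ _ c i)) <= 1 - fine (Wn N (@enc _ _ c i) (@dec _ _ c i)).
  set x := @enc _ _ c i; set D := @dec _ _ c i.
  have mD : measurable D by exact: dec_measurable.
  set A := [set y | info N S x y <= t].
  have mA : measurable A by exact: measurable_info_le.
  have mDA : measurable (D `&` A) by exact: measurableI.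
  rewrite WnE//.
  have h1 : fine (iprod (gauss N) x D) <= fine (iprod (gauss N) x (~` A)) + fine (iprod (gauss N) x (D `&` A)).
    rewrite -fineD ?fin_num_measure//; last exact: measurableC.
    apply: fine_le; rewrite ?fin_num_measure//.
      rewrite fin_numD !fin_num_measure//; exact: measurableC.
    apply: (@le_trans _ _ (iprod (gauss N) x (~` A `|` (D `&` A)))).
      apply: le_measure; rewrite ?inE//.
        by apply: measurableU => //; exact: measurableC.
      move=> y Dy; case: (pselect (A y)) => Ay; [by right|by left].
    by apply: measureU2 => //; exact: measurableC.
  have h2 : fine (iprod (gauss N) x (~` A)) = 1 - fine (iprod (gauss N) x A).
    by rewrite probability_setC// fineB ?fin_num_measure.
  have h3 : fine (iprod (gauss N) x (D `&` A)) <= expR t * fine (Q (D `&` A)).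
    by apply: iprod_le_expR_outdist => // y [].
  have h4 : expR t * fine (Q (D `&` A)) <= expR t * fine (Q D).
    rewrite ler_pM2l ?expR_gt0//; apply: fine_le; rewrite ?fin_num_measure//.
    by apply: le_measure; rewrite ?inE// => y [].
  move: h1 h2 h3 h4 (Hg i); rewrite -/x -/A.
  move: (fine (iprod _ x D)) (fine (iprod _ x (~` A))) (fine (iprod _ x (D `&` A)))
    (fine (iprod _ x A)) (expR t * fine (Q (D `&` A))) (expR t * fine (Q D)) => *.
  lra.
rewrite /Pe [leRHS]mulrC ler_pdivlMr// mulrBl divfK ?gt_eqF//.
apply: (@le_trans _ _ (\sum_(i < code_size c) (g - expR t * fine (Q (@dec _ _ c i))))); last first.
  exact: ler_sum.
rewrite sumrB sumr_const card_ord -mulr_sumr mulr_natr lerD2l lerN2.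
by rewrite ler_piMr ?expR_ge0// sum_dec_le1.
Qed.

Lemma near_sqrtn_ge (R : realType) (B : R) : exists n0, forall n, (n0 <= n)%N ->
  (0 < n)%N /\ B <= Num.sqrt n%:R.
Proof.
exists (Num.truncn (B ^+ 2)).+1 => n n0; split; first exact: leq_trans n0.
rewrite (le_trans (ler_norm B))// -sqrtr_sqr ler_wsqrtr//.
by rewrite ltW// (lt_le_trans (truncnS_gt _))// ler_nat.
Qed.

(** One tolerance rho for both perturbations: p collects the shifts of the threshold, q those of the
    variance. *)
Lemma G_ratio_continuous (R : realType) (b V e : R) : 0 < V -> 0 < e ->
  exists2 rho, 0 < rho & forall p q, `|p| <= rho -> `|q| <= rho ->
    `|G ((b + p) / Num.sqrt (V + q)) - G (b / Num.sqrt V)| <= e.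
Proof.
move=> V0 e0.
pose f (z : R * R) : R := G ((b + z.1) / Num.sqrt (V + z.2)).
have cf : f z @[z --> ((0 : R), (0 : R))] --> f (0, 0).
  apply: (@continuous_comp _ _ _ (fun z : R * R => (b + z.1) / Num.sqrt (V + z.2)) (@G R)); last exact: continuous_G.
  apply: cvgM.
    by apply: cvgD; [exact: cvg_cst|exact: cvg_fst].
  apply: cvgV; first by rewrite /= addr0 gt_eqF// sqrtr_gt0.
  apply: (@continuous_comp _ _ _ (fun z : R * R => V + z.2) Num.sqrt); last exact: sqrt_continuous.
  by apply: cvgD; [exact: cvg_cst|exact: cvg_snd].
move/cvgrPdist_le : cf => /(_ e e0) /nbhs_ballP[r /= r0 Hr].
exists (r / 2); first by rewrite divr_gt0.
move=> p q pr qr.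
have /= := Hr (p, q); rewrite /f/= !addr0 distrC; apply.
have r2 : r / 2 < r by rewrite ltr_pdivrMr// ltr_pMr// ltr1n.
by split; rewrite /ball/= sub0r normrN; exact: le_lt_trans r2.
Qed.

Lemma ratio_shift_le (R : realType) (b d A k : R) : 0 <= d -> 0 <= k -> 0 < A - k * d ->
  `|b| * k <= A -> b / Num.sqrt A <= (b + d) / Num.sqrt (A - k * d).
Proof.
move=> d0 k0 Akd bk.
have kd0 : 0 <= k * d by rewrite mulr_ge0.
have A0 : 0 < A by lra.
have sA : 0 < Num.sqrt A by rewrite sqrtr_gt0.
have sB : 0 < Num.sqrt (A - k * d) by rewrite sqrtr_gt0.
rewrite ler_pdivrMr// mulrAC ler_pdivlMr//.
have [b0|b0] := leP 0 b.
  apply: ler_pM; rewrite ?sqrtr_ge0 ?lerDl//.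
  by rewrite ler_wsqrtr//; lra.
have [bd|bd] := leP 0 (b + d).
  apply: (@le_trans _ _ 0); last by rewrite mulr_ge0// ltW.
  by rewrite mulr_le0_ge0// ltW.
(* Squaring reduces this to d (A (2 b + d) + b^2 k) <= 0, where 2 b + d <= b and b^2 k <= - b A. *)
suff : - (b + d) * Num.sqrt A <= - b * Num.sqrt (A - k * d) by rewrite !mulNr lerN2.
rewrite -(@ler_pXn2r _ 2)// ?nnegrE; [|by rewrite mulr_ge0 ?sqrtr_ge0//; lra..].
rewrite !exprMn !sqr_sqrtr ?(ltW A0) ?(ltW Akd)// !sqrrN.
have h1 : A * (2 * b + d) <= A * b by rewrite ler_pM2l//; lra.
have h2 : - b * (- b * k) <= - b * A.
  by rewrite ler_wpM2l//; [lra|move: bk; rewrite ltr0_norm].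
have h3 : 0 <= d * - (A * (2 * b + d) + b ^+ 2 * k) by rewrite mulr_ge0//; lra.
lra.
Qed.

Definition dispersion {R : realType} (N S : R) : R :=
  ((S / N) ^+ 2 + 2 * (S / N)) / (2 * (1 + S / N) ^+ 2).

(** The right side is the variance per letter of the quadratic form of [info_quadsum] at full power
    [sumsq x] = nS. *)
Lemma dispersionE (R : realType) (N S : R) : 0 < N -> 0 < S ->
  dispersion N S = 2 * (- S / (2 * N * (N + S))) ^+ 2 * N ^+ 2 + (N + S)^-1 ^+ 2 * N * S.
Proof.
move=> N0 S0; have K0 : N + S != 0 by rewrite gt_eqF// addr_gt0.
by rewrite /dispersion; field; rewrite K0 gt_eqF.
Qed.

Lemma dispersion_gt0 (R : realType) (N S : R) : 0 < N -> 0 < S -> 0 < dispersion N S.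
Proof.
move=> N0 S0; have := divr_gt0 S0 N0 => u0.
rewrite /dispersion; apply: divr_gt0.
  by apply: addr_gt0; [exact: exprn_gt0|exact: mulr_gt0].
by apply: mulr_gt0 => //; apply: exprn_gt0; exact: addr_gt0.
Qed.

(** The shift delta is fixed first; a small scale eta then makes both the added variance eta^2 and
    the smoothing cost 1 - G(delta / eta) small. *)
Lemma exists_eta (R : realType) (delta rho e : R) : 0 < delta -> 0 < rho -> 0 < e ->
  exists eta, [/\ 0 < eta, eta ^+ 2 <= rho & 1 - G (delta / eta) <= e].
Proof.
move=> d0 r0 e0; have [M HM] := G_cvgy e0.
pose M' := Num.max M 1; have M'0 : 0 < M' by rewrite lt_max ltr01 orbT.
pose eta := Num.min (Num.min 1 rho) (delta / M').
have eta0 : 0 < eta by rewrite !lt_min ltr01 r0 divr_gt0.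
have eta1 : eta <= 1 by rewrite !ge_min lexx.
have etar : eta <= rho by rewrite !ge_min lexx orbT.
have etad : eta <= delta / M' by rewrite !ge_min lexx !orbT.
exists eta; split => //; first by nra.
have : M <= delta / eta.
  rewrite ler_pdivlMr//; apply: (@le_trans _ _ (M' * eta)).
    by apply: ler_wpM2r; [exact: ltW|rewrite le_max lexx].
  by rewrite mulrC -ler_pdivlMr.
move/HM; lra.
Qed.

Lemma converse (R : realType) (N S b e : R) : 0 < N -> 0 < S -> 0 < e ->
  exists n0, forall n, (n0 <= n)%N -> forall c : Defs.code R n, power_ok S c ->
    n%:R * capG N S + b * Num.sqrt n%:R <= ln (code_size c)%:R ->
    G (b / Num.sqrt (dispersion N S)) - e <= Pe N c.
Proof.
move=> N0 S0 e0.
set V := dispersion N S; have V0 : 0 < V by exact: dispersion_gt0.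
pose K := N + S; have K0 : 0 < K by rewrite addr_gt0.
have e40 : 0 < e / 4 by rewrite divr_gt0.
have [rho rho0 Hrho] := G_ratio_continuous b V0 e40.
pose delta := rho / 2; have delta0 : 0 < delta by rewrite divr_gt0.
have [eta [eta0 eta2 etaG]] := exists_eta delta0 rho0 e40.
have [E E0 HE] := quadsum_clt_lower_sqrt (- S / (2 * N * K)) K^-1 N0 S0 eta0 delta0.
(* With t = ln M - g the term e^t / M of [Pe_ge] is e^(-g) <= e / 4; the absolute value keeps g
   nonnegative when e / 4 > 1. *)
pose g := `|ln (e / 4)|; have g0 : 0 <= g by exact: normr_ge0.
have eg : expR (- g) <= e / 4.
  rewrite -[leRHS]lnK ?posrE// ler_expR lerNl.
  by rewrite /g -normrN ler_norm.
(* The summands ensure in turn that g / sqrt n <= delta, that the error of the limit theorem is at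
   most e / 4, and that [ratio_shift_le] applies to all thresholds up to |b| + rho. *)
pose B := g / delta + E / (e / 4) + (`|b| + rho) * (2 * N / K) / V.
have [n0 Hn0] := near_sqrtn_ge B.
exists n0 => n nn0 c cS cM; have [npos Bn] := Hn0 n nn0.
have nR : 0 < n%:R :> R by rewrite ltr0n.
set r := Num.sqrt n%:R in Bn cM; have r0 : 0 < r by rewrite sqrtr_gt0.
have r2 : r ^+ 2 = n%:R by rewrite sqr_sqrtr// ltW.
have B1 : 0 <= g / delta by rewrite divr_ge0// ltW.
have B2 : 0 <= E / (e / 4) by rewrite divr_ge0// ltW.
have B3 : 0 <= (`|b| + rho) * (2 * N / K) / V.
  by nneg.
have n1 : g / r <= delta.
  by rewrite ler_pdivrMr// [leRHS]mulrC -ler_pdivrMr//; apply: le_trans Bn; rewrite /B; lra.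
have n2 : E / r <= e / 4.
  by rewrite ler_pdivrMr// [leRHS]mulrC -ler_pdivrMr//; apply: le_trans Bn; rewrite /B; lra.
have n3 : (`|b| + rho) * (2 * N / (K * r)) <= V.
  rewrite (_ : _ * _ = (`|b| + rho) * (2 * N / K) / r); last by field; rewrite !gt_eqF.
  by rewrite ler_pdivrMr// [leRHS]mulrC -ler_pdivrMr//; apply: le_trans Bn; rewrite /B; lra.
have M0 : 0 < (code_size c)%:R :> R by rewrite ltr0n code_size_gt0.
pose t := ln (code_size c)%:R - g.
have tM : expR t / (code_size c)%:R = expR (- g).
  by rewrite /t expRD lnK ?posrE// mulrAC mulfV ?mul1r// gt_eqF.
(* Three shares of e / 4 pay for the perturbation of [G], the smoothing and the limit theorem; the
   fourth is e^t / M. *)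
apply: le_trans (Pe_ge (g := G (b / Num.sqrt V) - e / 4 - e / 4 - e / 4) (t := t) N0 S0 _); last first.
  move=> i; set x := @enc _ _ c i.
  have xS : sumsq x <= n%:R * S by exact: cS.
  (* The loss of mean of this codeword in units of sqrt n; [vE] expresses its loss of variance
     through the same d. *)
  pose d := (n%:R * S - sumsq x) / (2 * K) / r.
  have d0 : 0 <= d by rewrite /d; apply: divr_ge0; [apply: divr_ge0; [rewrite subr_ge0|nneg]|exact: ltW].
  have := HE n x (b - g / r + d) npos xS.
  set v := 2 * _ ^+ 2 * _ + _.
  have vE : v = V - 2 * N / (K * r) * d.
    rewrite /v /V dispersionE// -/K /d -r2; field.
    by rewrite !gt_eqF.
  have v0 : 0 < v.
    rewrite /v ltr_pwDl//.
      rewrite mulr_gt0 ?exprn_gt0// mulr_gt0// lt_def sqr_ge0 andbT sqrf_eq0.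
      by rewrite mulf_neq0 ?oppr_eq0 ?invr_eq0 ?gt_eqF ?mulr_gt0.
    by have := sumsq_ge0 x => ?; nneg.
  rewrite -/r (_ : b - g / r + d - delta = (b - g / r - delta) + d); last by ring.
  pose b' := b - g / r - delta.
  have b'b : `|b'| <= `|b| + rho.
    rewrite /b' -addrA (le_trans (ler_normD _ _))// lerD2l -opprD normrN ger0_norm; last by rewrite addr_ge0 ?divr_ge0// ltW.
    by rewrite /delta in n1 *; lra.
  have s1 : b' / Num.sqrt (eta ^+ 2 + V) <= (b' + d) / Num.sqrt (eta ^+ 2 + v).
    rewrite vE addrA; apply: ratio_shift_le => //.
    - by nneg.
    - by rewrite -addrA -vE addr_gt0// exprn_gt0.
    - apply: (@le_trans _ _ V); last by rewrite lerDr sqr_ge0.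
      by apply: le_trans n3; apply: ler_wpM2r => //; nneg.
  have s2 : G (b / Num.sqrt V) - e / 4 <= G (b' / Num.sqrt (eta ^+ 2 + V)).
    have hp : `|- (g / r + delta)| <= rho.
      have gd : 0 <= g / r + delta by nneg.
      by rewrite normrN ger0_norm//; rewrite /delta in n1 *; lra.
    have hq : `|eta ^+ 2| <= rho by rewrite ger0_norm ?sqr_ge0.
    have := Hrho _ _ hp hq.
    rewrite (_ : b + - (g / r + delta) = b'); last by rewrite /b'; ring.
    by rewrite (addrC V) ler_norml => /andP[+ _]; lra.
  move: s1; rewrite -G_mono => s1 H.
  apply: le_trans (_ : _ <= fine (iprod (gauss N) x [set y |
       quadsum N (- S / (2 * N * K)) K^-1 x y <= (b - g / r + d) * r])) _.
    by apply: le_trans H; rewrite -/b'; lra.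
  apply: fine_le; rewrite ?fin_num_measure//; [exact: measurable_quadsum_le0|exact: measurable_info_le|].
  apply: le_measure; rewrite ?inE; [exact: measurable_quadsum_le0|exact: measurable_info_le|].
  move=> y /= qy; rewrite info_quadsum// -/K /t.
  move: qy; rewrite (_ : (b - g / r + d) * r = b * r - g + (n%:R * S - sumsq x) / (2 * K)); first lra.
  by rewrite /d; field; rewrite !gt_eqF.
rewrite tM; lra.
Qed.

(** * Achievability *)

Lemma eq_ler (R : realType) (x y : R) : x = y -> x <= y.
Proof. by move=> ->. Qed.

(** The width is of order sqrt n: this is the size of the fluctuations of [sumsq] under N(0, S)^n,
    and it moves the threshold, in units of sqrt n, only by a constant proportional to d. *)
Definition shell {R : realType} (S d : R) n : set (n.-tuple R) :=
  [set x | n%:R * S - d * Num.sqrt n%:R <= sumsq x <= n%:R * S].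
Arguments shell {R} S d n.

Lemma measurable_sumsq {R : realType} n : measurable_fun setT (@sumsq R n).
Proof. by apply: measurable_sum => i; apply: measurable_funX; exact: measurable_tnth. Qed.

Lemma measurable_shell {R : realType} (S d : R) n : measurable (@shell R S d n).
Proof.
have := @measurable_sumsq R n measurableT _ (measurable_itv `[n%:R * S - d * Num.sqrt n%:R, n%:R * S]).
by rewrite setTI (_ : _ @^-1` _ = shell S d n)//; apply/seteqP; split => y /=; rewrite in_itv.
Qed.

(** Lets the limit theorem for noise of variance S and codeword 0 estimate the probability of the
    shell. *)
Lemma quadsum_center {R : realType} (S : R) n (y : n.-tuple R) :
  quadsum S 1 0 (nseq_tuple n 0) y = sumsq y - n%:R * S.
Proof.
rewrite /quadsum /sumsq -[n in n%:R * S]card_ord -sumr_const mulr_suml -sumrB.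
by apply: eq_bigr => i _; rewrite tnth_nseq; ring.
Qed.

Lemma iprod_nseq d (T : measurableType d) (R : realType) (I : Type)
    (m : I -> probability T R) (a : I) n (D : set (n.-tuple T)) :
  iprod (fun _ => m a) (nseq_tuple n a) D = iprod m (nseq_tuple n a) D.
Proof.
elim: n D => [//|n IH] D; rewrite (iprodSE m) (iprodSE (fun _ => m a)).
have -> : thead (nseq_tuple n.+1 a) = a by rewrite /thead tnth_nseq.
have -> : [tuple of behead (nseq_tuple n.+1 a)] = nseq_tuple n a by exact/val_inj.
by apply: eq_integral => y _; exact: IH.
Qed.

Lemma outdistE (R : realType) (S : R) n (A : set (n.-tuple R)) :
  outdist S n A = iprod (gauss S) (nseq_tuple n 0) A.
Proof. exact: (iprod_nseq (gauss S)). Qed.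

Lemma shell_prob_ge (R : realType) (S d : R) : 0 < S -> 0 < d ->
  exists2 p, 0 < p & exists n0, forall n, (n0 <= n)%N -> p <= fine (outdist S n (shell S d n)).
Proof.
move=> S0 d0.
pose V := 2 * S ^+ 2; have V0 : 0 < V by rewrite /V mulr_gt0// exprn_gt0.
(* The limiting probability of the shell, as z^2 - S has variance 2 S^2 under N(0, S). *)
pose gap := G (0 / Num.sqrt V) - G (- d / Num.sqrt V).
have gap0 : 0 < gap.
  by rewrite subr_gt0 G_incr// ltr_pM2r ?invr_gt0 ?sqrtr_gt0// oppr_lt0.
have e0 : 0 < gap / 8 by rewrite divr_gt0.
have [rho1 rho10 H1] := G_ratio_continuous 0 V0 e0.
have [rho2 rho20 H2] := G_ratio_continuous (- d) V0 e0.
pose rho := Num.min rho1 rho2; have rho0 : 0 < rho by rewrite lt_min rho10.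
have r1 : rho <= rho1 by rewrite ge_min lexx.
have r2 : rho <= rho2 by rewrite ge_min lexx orbT.
have [eta [eta0 eta2 etaG]] := exists_eta rho0 rho0 e0.
have [E E0 HE] := quadsum_clt_lower_sqrt 1 0 S0 S0 eta0 rho0.
have [E' E'0 HE'] := quadsum_clt_upper_sqrt 1 0 S0 S0 eta0 rho0.
(* The errors amount to five times gap / 8: two perturbations of [G], two smoothings, and both limit
   theorem errors together. This leaves 3 gap / 8. *)
exists (gap / 4); first by rewrite divr_gt0.
have [n0 Hn0] := near_sqrtn_ge ((E + E') / (gap / 8)).
exists n0 => n /Hn0[npos Bn].
have nR : 0 < n%:R :> R by rewrite ltr0n.
set r := Num.sqrt n%:R in Bn *; have rp : 0 < r by rewrite sqrtr_gt0.
have nE : E / r + E' / r <= gap / 8 by rewrite -mulrDl ler_pdivrMr// mulrC -ler_pdivrMr.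
set z := nseq_tuple n (0 : R).
have zS : sumsq z = 0 by rewrite /sumsq big1// => i _; rewrite tnth_nseq expr0n.
have zS' : sumsq z <= n%:R * S by rewrite zS mulr_ge0 ?ltW.
have := HE n z 0 npos zS'; have := HE' n z (- d) npos zS'.
rewrite zS mul0r mulr0 addr0 expr1n mulr1 -/V -/r mul0r.
set A := [set y | quadsum S 1 0 z y <= 0]; set B := [set y | quadsum S 1 0 z y <= - d * r].
have mA : measurable A by exact: measurable_quadsum_le0.
have mB : measurable B by exact: measurable_quadsum_le0.
have rhoN : `|rho| <= rho by rewrite gtr0_norm.
have eN : `|eta ^+ 2| <= rho by rewrite ger0_norm// sqr_ge0.
have := H1 (- rho) (eta ^+ 2) _ (le_trans eN r1).
rewrite normrN (addrC V) => /(_ (le_trans rhoN r1)); rewrite ler_norml => /andP[G1 _].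
have := H2 rho (eta ^+ 2) (le_trans rhoN r2) (le_trans eN r2).
rewrite (addrC V) ler_norml => /andP[_ G2].
move=> U L.
apply: (@le_trans _ _ (fine (iprod (gauss S) z (shell S d n)))); last first.
  apply: eq_ler; exact: (esym (congr1 fine (outdistE S (shell S d n)))).
have sub : fine (iprod (gauss S) z A) <= fine (iprod (gauss S) z (shell S d n)) + fine (iprod (gauss S) z B).
  have ms := @measurable_shell R S d n.
  rewrite -fineD ?fin_num_measure//.
  apply: fine_le; rewrite ?fin_num_measure//.
    by rewrite fin_numD !fin_num_measure.
  apply: (@le_trans _ _ (iprod (gauss S) z (shell S d n `|` B))); last exact: measureU2.
  apply: le_measure; rewrite ?inE//; first exact: measurableU.
  move=> y; rewrite /A /B /shell /=; rewrite !quadsum_center subr_le0 => yA.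
  case: (leP (sumsq y - n%:R * S) (- d * r)) => yB; [by right|left].
  by apply/andP; split => //; move: yB; rewrite mulNr -/r; lra.
move: sub U L G1 G2 etaG; rewrite /gap in e0 nE *.
move: (fine (iprod _ z A)) (fine (iprod _ z B)) (fine (iprod _ z (shell S d n))) => pA pB pF.
move: (G ((0 - rho) / _)) (G ((- d + rho) / _)) (G (rho / eta)) => g1 g2 g3.
rewrite /gap in nE.
lra.
Qed.

(** * Feinstein's greedy construction *)

(** Functions on all of [nat], constrained below k only: a codeword is added by overriding the value
    at k. *)
Definition partial_code {R : realType} (N S t eps : R) n (F : set (n.-tuple R)) (k : nat) : Prop :=
  exists (e : nat -> n.-tuple R) (D : nat -> set (n.-tuple R)),
    (forall i, (i < k)%N -> [/\ F (e i), measurable (D i),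
       D i `<=` [set y | t <= info N S (e i) y] & 1 - eps <= fine (iprod (gauss N) (e i) (D i))]) /\
    (forall i j, (i < k)%N -> (j < k)%N -> i != j -> D i `&` D j = set0).

(* Feinstein: if no codeword can be added, the union U of the decoding sets has
   W_x(U) >= tau for every x in F, hence Q(U) >= tau P(F); but Q(U) <= k e^(-t). *)
Lemma partial_code_extend (R : realType) (N S t eps tau : R) n (F : set (n.-tuple R)) (k : nat) :
  0 < N -> 0 < S -> 0 <= tau -> measurable F ->
  (forall x, F x -> fine (iprod (gauss N) x [set y | info N S x y <= t]) <= eps - tau) ->
  k%:R < expR t * (tau * fine (outdist S n F)) ->
  partial_code N S t eps F k -> partial_code N S t eps F k.+1.
Proof.
move=> N0 S0 tau0 mF HF kt [e [D [H1 H2]]].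
pose U := \big[setU/set0]_(i < k) D i.
have mD i : (i < k)%N -> measurable (D i) by move=> /H1[].
have mU : measurable U by apply: bigsetU_measurable => i _; exact: mD.
have QU : expR t * fine (outdist (N + S) n U) <= k%:R.
  apply: (@le_trans _ _ (\sum_(i < k) expR t * fine (outdist (N + S) n (D i)))).
    rewrite -mulr_sumr ler_pM2l ?expR_gt0//.
    have : (outdist (N + S) n U <= \sum_(i < k) outdist (N + S) n (D i))%E.
      by apply: Boole_inequality.
    rewrite -lee_fin fineK ?fin_num_measure// -sumEFin => /le_trans; apply.
    rewrite le_eqVlt; apply/orP; left; apply/eqP; apply: eq_bigr => i _.
    by rewrite fineK// fin_num_measure//; exact: mD.
  rewrite -[k in k%:R]card_ord -sumr_const; apply: ler_sum => i _.
  have [_ mDi Dt _] := H1 i (ltn_ord i).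
  apply: le_trans (expR_outdist_le_iprod N0 S0 mDi Dt) _.
  by rewrite -lee_fin fineK ?fin_num_measure//; exact: probability_le1.
pose A (x : n.-tuple R) := [set y | t < info N S x y].
have mA x : measurable (A x).
  rewrite (_ : A x = ~` [set y | info N S x y <= t]); first by apply: measurableC; exact: measurable_info_le.
  by apply/funext => y; rewrite /A /setC /mkset; apply/propext; rewrite ltNge; split => /negP.
have [[x [Fx Px]]|nx] := pselect (exists x, F x /\ 1 - eps <= fine (iprod (gauss N) x (A x `\` U))).
  exists (fun i => if i == k then x else e i), (fun i => if i == k then A x `\` U else D i).
  split.
    move=> i; rewrite ltnS leq_eqVlt; case: eqP => [-> _|ik /= ilt]; last exact: H1.
    split => //; first exact: measurableD.
    by move=> y [/= /ltW].
  have DU i : (i < k)%N -> D i `&` (A x `\` U) = set0.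
    move=> ik; apply/seteqP; split => // y [Dy [_ Uy]]; apply: Uy.
    rewrite /U -bigcup_mkord; exists i => //.
  move=> i j; rewrite !ltnS leq_eqVlt (leq_eqVlt j).
  case: (eqVneq i k) => [->|ik]; case: (eqVneq j k) => [->|jk] //=.
  - by move=> _ jk' _; rewrite setIC; exact: DU.
  - by move=> ik' _ _; exact: DU.
  - by move=> ik' jk'; exact: H2.
exfalso.
have : tau * fine (outdist S n F) <= fine (outdist (N + S) n U).
  apply: outdist_ge_inputs => // x Fx.
  (* By [HF] the set A x has probability at least 1 - eps + tau, so more than tau of it must lie in
     U. *)
  have h1 : fine (iprod (gauss N) x (A x `\` U)) < 1 - eps.
    by rewrite ltNge; apply/negP => h; apply: nx; exists x.
  have h2 : fine (iprod (gauss N) x (A x)) = 1 - fine (iprod (gauss N) x [set y | info N S x y <= t]).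
    have m := @measurable_info_le R N S t n x.
    rewrite -(_ : fine (iprod (gauss N) x (~` [set y | info N S x y <= t])) = 1 - fine (iprod (gauss N) x [set y | info N S x y <= t])).
      by congr (fine (iprod _ _ _)); apply/funext => y; rewrite /A /setC /mkset; apply/propext; rewrite ltNge; split => /negP.
    by rewrite probability_setC// fineB ?fin_num_measure.
  have mAU : measurable (A x `\` U) by exact: measurableD.
  have h3 : fine (iprod (gauss N) x (A x)) <= fine (iprod (gauss N) x (A x `\` U)) + fine (iprod (gauss N) x U).
    rewrite -fineD ?fin_num_measure//.
    apply: fine_le; rewrite ?fin_num_measure//.
      by rewrite fin_numD !fin_num_measure.
    apply: (@le_trans _ _ (iprod (gauss N) x ((A x `\` U) `|` U))); last exact: measureU2.
    apply: le_measure; rewrite ?inE//; first exact: measurableU.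
    by move=> y Ay; case: (pselect (U y)) => Uy; [right|left].
  move: (HF x Fx) h1 h2 h3.
  move: (fine (iprod _ x (A x))) (fine (iprod _ x (A x `\` U))) (fine (iprod _ x U)) (fine (iprod _ x _)) => *; lra.
rewrite -(ler_pM2l (expR_gt0 t)) => h.
by have := le_lt_trans (le_trans h QU) kt; rewrite ltxx.
Qed.

Lemma partial_code_exists (R : realType) (N S t eps tau : R) n (F : set (n.-tuple R)) (k : nat) :
  0 < N -> 0 < S -> 0 <= tau -> measurable F ->
  (forall x, F x -> fine (iprod (gauss N) x [set y | info N S x y <= t]) <= eps - tau) ->
  (forall j, (j < k)%N -> j%:R < expR t * (tau * fine (outdist S n F))) ->
  partial_code N S t eps F k.
Proof.
move=> N0 S0 tau0 mF HF; elim: k => [|k IH] Hk.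
  by exists (fun _ => nseq_tuple n 0), (fun _ => set0).
apply: (partial_code_extend N0 S0 tau0 mF HF); first exact: Hk.
by apply: IH => j jk; apply: Hk; exact: ltnW.
Qed.

Lemma code_of_partial (R : realType) (N S t eps : R) n (F : set (n.-tuple R)) (k : nat) :
  (0 < k)%N -> partial_code N S t eps F k -> (forall x, F x -> sumsq x <= n%:R * S) ->
  exists c : Defs.code R n, [/\ power_ok S c, code_size c = k & Pe N c <= eps].
Proof.
move=> k0 [e [D [H1 H2]]] HF.
have mD (i : 'I_k) : measurable (D i) by have [] := H1 i (ltn_ord i).
have dD (i j : 'I_k) : i != j -> D i `&` D j = set0 by move=> ij; exact: H2.
exists (@Defs.Code R n k k0 (fun i => e i) (fun i => D i) mD dD); split => //.
  by move=> i; apply: HF; have [] := H1 i (ltn_ord i).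
rewrite /Pe /= mulrC ler_pdivrMr ?ltr0n//.
rewrite -[k in eps * k%:R]card_ord mulrC -sumr_const mulr_suml; apply: ler_sum => i _.
rewrite WnE// mul1r; have [_ _ _] := H1 i (ltn_ord i).
by move: (fine _) => p; lra.
Qed.

Lemma achievability (R : realType) (N S b e : R) : 0 < N -> 0 < S -> 0 < e ->
  exists n0, forall n, (n0 <= n)%N -> exists c : Defs.code R n, [/\ power_ok S c,
    n%:R * capG N S + b * Num.sqrt n%:R <= ln (code_size c)%:R &
    Pe N c <= G (b / Num.sqrt (dispersion N S)) + e].
Proof.
move=> N0 S0 e0.
set V := dispersion N S; have V0 : 0 < V by exact: dispersion_gt0.
pose K := N + S; have K0 : 0 < K by rewrite addr_gt0.
have e50 : 0 < e / 5 by rewrite divr_gt0.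
have [rho rho0 Hrho] := G_ratio_continuous b V0 e50.
pose delta := rho / 3; have delta0 : 0 < delta by rewrite divr_gt0.
have [eta [eta0 eta2 etaG]] := exists_eta delta0 rho0 e50.
have [E E0 HE] := quadsum_clt_upper_sqrt (- S / (2 * N * K)) K^-1 N0 S0 eta0 delta0.
(* This width makes the threshold shift of every codeword of the shell at most delta. *)
pose d1 := delta * (2 * K); have d10 : 0 < d1 by rewrite mulr_gt0// mulr_gt0.
have [p p0 [n1 Hp]] := shell_prob_ge S0 d10.
pose tau := e / 5.
have tp0 : 0 < tau * p / 2 by rewrite divr_gt0// mulr_gt0.
(* The code will have at least e^t tau p / 2 codewords; adding L to the threshold t compensates
   exactly for the factor tau p / 2. *)
pose L := - ln (tau * p / 2).
(* In turn: the shift L / sqrt n is at most delta, the limit theorem error at most e / 5, and the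
   loss of variance in the shell at most rho. *)
pose B := `|L| / delta + E / (e / 5) + 2 * N / K * delta / rho.
have [n2 Hn2] := near_sqrtn_ge B.
exists (maxn n1 n2) => n; rewrite geq_max => /andP[nn1 nn2].
have [npos Bn] := Hn2 n nn2; have pn := Hp n nn1.
have nR : 0 < n%:R :> R by rewrite ltr0n.
set r := Num.sqrt n%:R in Bn *; have r0 : 0 < r by rewrite sqrtr_gt0.
have r2 : r ^+ 2 = n%:R by rewrite sqr_sqrtr// ltW.
have B1 : 0 <= `|L| / delta by rewrite divr_ge0// ltW.
have B2 : 0 <= E / (e / 5) by rewrite divr_ge0// ltW.
have B3 : 0 <= 2 * N / K * delta / rho by nneg.
have m1 : `|L| / r <= delta.
  by rewrite ler_pdivrMr// [leRHS]mulrC -ler_pdivrMr//; apply: le_trans Bn; rewrite /B; lra.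
have m2 : E / r <= e / 5.
  by rewrite ler_pdivrMr// [leRHS]mulrC -ler_pdivrMr//; apply: le_trans Bn; rewrite /B; lra.
have m3 : 2 * N / K * delta / r <= rho.
  by rewrite ler_pdivrMr// [leRHS]mulrC -ler_pdivrMr//; apply: le_trans Bn; rewrite /B; lra.
pose t := n%:R * capG N S + b * r + L.
set eps := G (b / Num.sqrt V) + e.
have HF x : shell S d1 n x -> fine (iprod (gauss N) x [set y | info N S x y <= t]) <= eps - tau.
  move=> /andP[xl xu].
  pose d := (n%:R * S - sumsq x) / (2 * K) / r.
  have d0 : 0 <= d by rewrite /d; apply: divr_ge0; [apply: divr_ge0; [rewrite subr_ge0|nneg]|exact: ltW].
  have dd : d <= delta.
    rewrite /d ler_pdivrMr// ler_pdivrMr ?mulr_gt0// mulrAC -/d1 -/r.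
    by move: xl; rewrite -/r; lra.
  have := HE n x (b + L / r + d) npos xu.
  set v := 2 * _ ^+ 2 * _ + _.
  have vE : v = V - 2 * N / (K * r) * d.
    rewrite /v /V dispersionE// -/K /d -r2; field.
    by rewrite !gt_eqF.
  rewrite vE (_ : b + L / r + d + delta = b + (L / r + d + delta)); last by ring.
  rewrite (_ : eta ^+ 2 + (V - 2 * N / (K * r) * d) = V + (eta ^+ 2 - 2 * N / (K * r) * d)); last by ring.
  have q0 : 0 <= 2 * N / (K * r) * d by nneg.
  have q1 : 2 * N / (K * r) * d <= rho.
    apply: le_trans m3; rewrite (_ : 2 * N / (K * r) * d = 2 * N / K / r * d); last by field; rewrite !gt_eqF.
    rewrite [leRHS]mulrAC; apply: ler_wpM2l => //; nneg.
  have := Hrho (L / r + d + delta) (eta ^+ 2 - 2 * N / (K * r) * d) _ _.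
  move=> HG.
  have {HG} : `|G ((b + (L / r + d + delta)) / Num.sqrt (V + (eta ^+ 2 - 2 * N / (K * r) * d))) - G (b / Num.sqrt V)| <= e / 5.
    apply: HG.
      have ri0 : 0 <= r^-1 by nneg.
      rewrite -addrA (le_trans (ler_normD _ _))// normrM (ger0_norm ri0).
      have dd0 : 0 <= d + delta by nneg.
      rewrite (ger0_norm dd0).
      by move: m1 dd; rewrite /delta; lra.
    by rewrite ler_norml; have := sqr_ge0 eta; lra.
  rewrite ler_norml => /andP[_ HG] HU.
  apply: (@le_trans _ _ (fine (iprod (gauss N) x [set y |
       quadsum N (- S / (2 * N * K)) K^-1 x y <= (b + L / r + d) * r]))).
    apply: fine_le; rewrite ?fin_num_measure//; [exact: measurable_info_le|exact: measurable_quadsum_le0|].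
    apply: le_measure; rewrite ?inE; [exact: measurable_info_le|exact: measurable_quadsum_le0|].
    move=> y /=; rewrite info_quadsum// -/K /t.
    rewrite -/r (_ : (b + L / r + d) * r = b * r + L + (n%:R * S - sumsq x) / (2 * K)); first lra.
    by rewrite /d; field; rewrite !gt_eqF.
  by move: HU HG etaG m2; rewrite -/r /eps /tau; move: (G _) (G _) (G _) (fine _) => *; lra.
pose y := expR t * (tau * fine (outdist S n (shell S d1 n))).
have y0 : 0 < y by rewrite mulr_gt0 ?expR_gt0// mulr_gt0//; exact: lt_le_trans pn.
(* Halving y leaves room for rounding: k is positive and exceeds y / 2, yet every j < k satisfies j
   <= y / 2 < y. *)
pose k := (Num.truncn (y / 2)).+1.
have Hk j : (j < k)%N -> j%:R < y.
  rewrite ltnS => jk; apply: (@le_lt_trans _ _ (y / 2)); last by rewrite ltr_pdivrMr// ltr_pMr// ltr1n.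
  rewrite (le_trans (_ : _ <= (Num.truncn (y / 2))%:R)) ?ler_nat//.
  by rewrite truncn_le// divr_ge0// ltW.
have pc : partial_code N S t eps (shell S d1 n) k.
  apply: (@partial_code_exists _ _ _ _ _ tau) => //; [exact: ltW|exact: measurable_shell].
have [c [cS cM cP]] := code_of_partial (isT : (0 < k)%N) pc (fun x Fx => proj2 (andP Fx)).
exists c; split => //; rewrite cM.
have ky : expR t * (tau * p / 2) <= k%:R.
  apply: (@le_trans _ _ (y / 2)); last by rewrite ltW// truncnS_gt.
  rewrite /y -[leRHS]mulrA; apply: ler_wpM2l; first exact: expR_ge0.
  by apply: ler_wpM2r => //; apply: ler_wpM2l => //; exact: ltW.
rewrite -ler_expR lnK ?posrE ?ltr0n//; apply: le_trans ky.
by rewrite /t [expR (_ + L)]expRD /L expRN lnK ?posrE// mulfVK// gt_eqF.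
Qed.

(** * Asymptotics *)

Lemma lt_limn_einf (R : realType) (u : nat -> \bar R) (x : \bar R) :
  (x < limn_einf u)%E -> exists n0, forall n, (n0 <= n)%N -> (x < u n)%E.
Proof.
rewrite limn_einf_lim (_ : limn (einfs u) = ereal_sup (range (einfs u))); last first.
  by apply/cvg_lim => //; apply: ereal_nondecreasing_cvgn; exact: nondecreasing_einfs.
move=> /ereal_sup_gt[_ [n0 _ <-] xn0]; exists n0 => n n0n.
by apply: (lt_le_trans xn0); apply: ereal_inf_lbound; exists n.
Qed.

Lemma le_limn_einf (R : realType) (u : nat -> \bar R) (x : \bar R) n0 :
  (forall n, (n0 <= n)%N -> (x <= u n)%E) -> (x <= limn_einf u)%E.
Proof.
move=> H.
rewrite limn_einf_lim (_ : limn (einfs u) = ereal_sup (range (einfs u))); last first.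
  by apply/cvg_lim => //; apply: ereal_nondecreasing_cvgn; exact: nondecreasing_einfs.
apply: (@le_trans _ _ (einfs u n0)); last by apply: ereal_sup_ubound; exists n0.
by apply: le_ereal_inf_tmp => _ [n /= n0n <-]; exact: H.
Qed.

Lemma limn_esup_le (R : realType) (u : nat -> \bar R) (x : \bar R) n0 :
  (forall n, (n0 <= n)%N -> (u n <= x)%E) -> (limn_esup u <= x)%E.
Proof.
move=> H.
rewrite limn_esup_lim (_ : limn (esups u) = ereal_inf (range (esups u))); last first.
  by apply/cvg_lim => //; apply: ereal_nonincreasing_cvgn; exact: nonincreasing_esups.
apply: (@le_trans _ _ (esups u n0)); first by apply: ereal_inf_lbound; exists n0.
by apply: ge_ereal_sup => _ [n /= n0n <-]; exact: H.
Qed.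

Lemma le_limn_esup (R : realType) (u : nat -> \bar R) (x : \bar R) n0 :
  (forall n, (n0 <= n)%N -> (x <= u n)%E) -> (x <= limn_esup u)%E.
Proof.
move=> H.
rewrite limn_esup_lim (_ : limn (esups u) = ereal_inf (range (esups u))); last first.
  by apply/cvg_lim => //; apply: ereal_nonincreasing_cvgn; exact: nonincreasing_esups.
apply: le_ereal_inf_tmp => _ [m _ <-].
apply: (@le_trans _ _ (u (maxn m n0))); first by apply: H; rewrite leq_maxr.
by apply: ereal_sup_ubound; exists (maxn m n0) => //=; rewrite leq_maxl.
Qed.

(** Strictness matters: only below its lower limit is the rate eventually bounded from below by
    b. *)
Lemma G_le_limn_esup (R : realType) (N S b : R) (c : forall n, Defs.code R n) :
  0 < N -> 0 < S -> (forall n, power_ok S (c n)) -> (b%:E < limn_einf (rate2 N S c))%E ->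
  ((G (b / Num.sqrt (dispersion N S)))%:E <= limn_esup (PeE N c))%E.
Proof.
move=> N0 S0 cS /lt_limn_einf[n1 Hn1].
apply/lee_subgt0Pr => e e0; rewrite -EFinB.
have [n2 Hn2] := converse b N0 S0 e0.
(* n = 0 is excluded because [rate2] divides by sqrt n. *)
apply: (@le_limn_esup _ _ _ (maxn 1 (maxn n1 n2))) => n.
rewrite !geq_max => /and3P[n0 nn1 nn2].
rewrite /PeE lee_fin; apply: Hn2 => //.
have := Hn1 n nn1; rewrite /rate2 lte_fin ltr_pdivlMr ?sqrtr_gt0 ?ltr0n//.
by move/ltW; rewrite lerBrDl.
Qed.

(** Fills the small block lengths that [achievability] does not cover. *)
Lemma exists_trivial_code (R : realType) (S : R) n : 0 < S ->
  exists c : Defs.code R n, power_ok S c.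
Proof.
move=> S0.
have dD (i j : 'I_1) : i != j -> @setT (n.-tuple R) `&` setT = set0 by rewrite !ord1 eqxx.
exists (@Defs.Code R n 1 isT (fun _ => nseq_tuple n 0) (fun _ => setT) (fun _ => measurableT) dD).
move=> i /=; rewrite big1; first by rewrite mulr_ge0// ltW.
by move=> j _; rewrite tnth_nseq expr0n.
Qed.

Lemma exists_code_sequence (R : realType) (N S b e : R) : 0 < N -> 0 < S -> 0 < e ->
  exists c : forall n, Defs.code R n, [/\ forall n, power_ok S (c n),
    (b%:E <= limn_einf (rate2 N S c))%E &
    (limn_esup (PeE N c) <= (G (b / Num.sqrt (dispersion N S)) + e)%:E)%E].
Proof.
move=> N0 S0 e0; have [n0 Hn0] := achievability b N0 S0 e0.
have H n : exists c : Defs.code R n, power_ok S c /\ ((n0 <= n)%N ->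
    n%:R * capG N S + b * Num.sqrt n%:R <= ln (code_size c)%:R /\
    Pe N c <= G (b / Num.sqrt (dispersion N S)) + e).
  have [nn|nn] := leqP n0 n; first by have [c [h1 h2 h3]] := Hn0 n nn; exists c.
  by have [c cS] := @exists_trivial_code R S n S0; exists c.
exists (fun n => projT1 (cid (H n))); split.
- by move=> n; case: (cid (H n)) => c [].
- apply: (@le_limn_einf _ _ _ (maxn 1 n0)) => n; rewrite geq_max => /andP[n1 nn].
  rewrite /rate2; case: (cid (H n)) => c [_ /(_ nn)[h _]] /=.
  by rewrite lee_fin ler_pdivlMr ?sqrtr_gt0 ?ltr0n// lerBrDl.
- apply: (@limn_esup_le _ _ _ n0) => n nn.
  by rewrite /PeE; case: (cid (H n)) => c [_ /(_ nn)[_ h]] /=; rewrite lee_fin.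
Qed.

Theorem mainTheorem4 (R : realType) (N S : R) :
  0 < N -> 0 < S ->
  let V := ((S / N) ^+ 2 + 2 * (S / N)) / (2 * (1 + S / N) ^+ 2) in
  (forall a : R, Cp N S a = (G (a / Num.sqrt V))%:E) /\
  (forall eps : R, 0 < eps < 1 -> Ceps N S eps = (Num.sqrt V * Ginv eps)%:E).
Proof.
move=> N0 S0; rewrite -/(dispersion N S); cbv zeta.
have V0 := dispersion_gt0 N0 S0.
set V := dispersion N S in V0 *.
have sV : 0 < Num.sqrt V by rewrite sqrtr_gt0.
split=> [a|eps eps01].
  apply/eqP; rewrite eq_le; apply/andP; split.
    apply/lee_addgt0Pr => e e0; rewrite -EFinD.
    have [c [cS cr cP]] := exists_code_sequence a N0 S0 e0.
    by apply: le_trans cP; apply: ereal_inf_lbound; exists c.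
  apply: le_ereal_inf_tmp => _ [c [cS cr] <-].
  apply/lee_subgt0Pr => e e0; rewrite -EFinB.
  (* The lower limit may equal a, so the converse is applied at a - rho, and continuity of [G]
     recovers a. *)
  have [rho rho0 Hrho] := G_ratio_continuous a V0 e0.
  have := Hrho (- rho) 0; rewrite normrN normr0 addr0 gtr0_norm// => /(_ (lexx _) (ltW rho0)).
  rewrite ler_norml => /andP[h _].
  apply: (@le_trans _ _ (G ((a - rho) / Num.sqrt V))%:E); first by rewrite lee_fin; lra.
  apply: G_le_limn_esup => //; apply: lt_le_trans cr.
  by rewrite lte_fin ltrBlDr ltrDl.
have Geps : G (Ginv eps) = eps.
  have [x Gx] := G_surj eps01.
  exact: (@xgetPex _ 0 [set x | G x = eps] (ex_intro _ x Gx)).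
set a := Num.sqrt V * Ginv eps.
have aV : a / Num.sqrt V = Ginv eps by rewrite /a mulrAC mulfV ?mul1r// gt_eqF.
apply/eqP; rewrite eq_le; apply/andP; split.
  (* A lower limit above a + e would force the limiting error up to G((a + e) / sqrt V) > eps. *)
  apply: ge_ereal_sup => _ [c [cS cP] <-].
  apply/lee_addgt0Pr => e e0; rewrite -EFinD leNgt; apply/negP => h.
  have := le_trans (G_le_limn_esup N0 S0 cS h) cP.
  rewrite lee_fin -[leRHS]Geps G_mono -aV leNgt => /negP; apply.
  by rewrite ltr_pM2r ?invr_gt0// ltrDl.
apply/lee_subgt0Pr => e e0; rewrite -EFinB.
(* Backing off to the rate a - e frees this amount of error probability, which serves as the
   tolerance of [exists_code_sequence]. *)
have e1 : 0 < eps - G ((a - e) / Num.sqrt V).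
  by rewrite subr_gt0 -[ltRHS]Geps -aV G_incr// ltr_pM2r ?invr_gt0// ltrBlDr ltrDl.
have [c [cS cr cP]] := exists_code_sequence (a - e) N0 S0 e1.
apply: (le_trans cr); apply: ereal_sup_ubound; exists c => //; split => //.
by apply: (le_trans cP); rewrite addrC subrK.
Qed.
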